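(* Let $q\ge 2$ be an integer and let $g$ be a real function on the primes with $g(p)/p\to 0$ as $p\to\infty$. Then for every sufficiently large prime $p$, every simplicial complex $\Sigma$ on the vertex set $[p]=\{1,\dots,p\}$ that is invariant under $j\mapsto j+1\bmod p$ and is $\left(\frac{p}{q}-g(p)\right)$-connected has no independent set of size $q+1$; that is, every independent set of such a $\Sigma$ has at most $q$ vertices.
   Context: An independent set of a simplicial complex is a set of vertices no two of which form an edge. A space $X$ is $k$-connected (for real $k$) if $\pi_j(X)$ is trivial for all integers $j\le k$ (with $(-1)$-connected meaning non-empty). The paper phrases this as: for sufficiently large primes $p$, the maximal size of an independent set in any $\mathbb{Z}/p$-invariant complex on $[p]$ that is $(\frac{p}{q}-o(p))$-connected is $q$. *)

(* Defs.v *)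
From HB Require Import structures.
From mathcomp Require Import all_boot all_order all_algebra.
From mathcomp Require Import all_classical all_reals all_analysis.
Import Order.TTheory GRing.Theory Num.Theory.
Import numFieldNormedType.Exports.

Set Implicit Arguments.
Unset Strict Implicit.
Unset Printing Implicit Defensive.

Local Open Scope classical_set_scope.
Local Open Scope ring_scope.

Section HomotopySets.
Variables (R : realType) (T : topologicalType).

(* For j = 0 the cube is a single point and its boundary is empty. *)
Definition cube (j : nat) : set 'rV[R]_j :=
  [set s : 'rV[R]_j | forall i, 0 <= s ord0 i <= 1].

Definition cube_boundary (j : nat) : set 'rV[R]_j :=
  [set s : 'rV[R]_j | cube s /\ exists i, s ord0 i = 0 \/ s ord0 i = 1].

(* Based maps (I^j, boundary of I^j) -> (X, x0). They are represented by total
   functions on 'rV_j, whose values outside the cube are irrelevant: neither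
   the conditions below nor [homotopic_rel] depend on them. *)
Definition based_map (j : nat) (X : set T) (x0 : T) : set ('rV[R]_j -> T) :=
  [set f | [/\ {within @cube j, continuous f},
               f @` @cube j `<=` X
             & forall s, cube_boundary s -> f s = x0]].

Definition homotopic_rel (j : nat) (X : set T) (x0 : T)
    (f g : 'rV[R]_j -> T) : Prop :=
  exists H : 'rV[R]_j * R -> T,
    [/\ {within @cube j `*` `[0, 1], continuous H},
        H @` (@cube j `*` `[0, 1]) `<=` X,
        forall s (t : R), cube_boundary s -> 0 <= t <= 1 -> H (s, t) = x0,
        forall s, cube s -> H (s, 0) = f s
      & forall s, cube s -> H (s, 1) = g s].

Definition homotopy_class (j : nat) (X : set T) (x0 : T)
    (f : 'rV[R]_j -> T) : set ('rV[R]_j -> T) :=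
  [set g | based_map X x0 g /\ homotopic_rel X x0 f g].

(* The underlying set of pi_j(X, x0). *)
Definition homotopy_set (j : nat) (X : set T) (x0 : T) :
    set (set ('rV[R]_j -> T)) :=
  [set homotopy_class X x0 f | f in based_map X x0].

(* The class of the constant map is the neutral element of pi_j(X, x0). *)
Definition trivial_pi (j : nat) (X : set T) (x0 : T) : Prop :=
  @homotopy_set j X x0 = [set homotopy_class X x0 (cst x0)].

(* The integers j <= k to consider are -1 (nonemptiness) and the naturals. *)
Definition k_connected (X : set T) (k : R) : Prop :=
  (-1 <= k -> X !=set0) /\
  forall j : nat, j%:R <= k -> forall x0, X x0 -> trivial_pi j X x0.

End HomotopySets.

(* A complex is given by the set of its faces, the empty face included; its
   vertex set is all of V. *)
Definition simplicial_complex (V : finType) (S : {set {set V}}) : Prop :=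
  (forall s t : {set V}, s \in S -> t \subset s -> t \in S) /\
  (forall v : V, [set v]%SET \in S).

Definition independent (V : finType) (S : {set {set V}}) (A : {set V}) : Prop :=
  forall u v, u \in A -> v \in A -> u != v -> [set u; v]%SET \notin S.

(* [p] is identified with 'I_p = {0, ..., p - 1}; ordS is j |-> j + 1 mod p. *)
Definition cyclic_invariant (p : nat) (S : {set {set 'I_p}}) : Prop :=
  forall s : {set 'I_p}, s \in S -> (@ordS p @: s)%SET \in S.

(* Barycentric coordinates, with the topology induced by that of R^p. *)
Definition realization (R : realType) (p : nat) (S : {set {set 'I_p}}) :
    set 'rV[R]_p :=
  [set x : 'rV[R]_p | [/\ forall i, 0 <= x ord0 i,
               \sum_i x ord0 i = 1
             & [set i | x ord0 i != 0]%SET \in S]].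

Arguments realization R {p} S.

(* Main.v *)
Require Import Defs.
From mathcomp Require Import all_boot all_order all_algebra.
From mathcomp Require Import all_classical all_reals all_analysis.
From mathcomp Require Import ring lra.

(* If A is independent then so are its translates, so a translate of A meets a
   face s in at most one vertex; hence (a, v) |-> a - v is injective on A x s and
   |A||s| <= p. If |A| > q, the complex has dimension below p/(q+1), which for
   large p is within the assumed connectivity p/q - g(p). Contracting the
   faces one at a time then makes the realization X a retract of the full simplex
   (homotopy extension is explicit, by truncating barycentric coordinates). By
   Brouwer's theorem, proved through Sperner's lemma mod 2 on iterated barycentric
   subdivisions, the retraction followed by the rotation has a fixed point. It is a
   point of X fixed by the rotation, i.e. the barycenter of the full simplex, so
   all of [p] is a face, contradicting independence of A. *)

Set Implicit Arguments.
Unset Strict Implicit.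
Unset Printing Implicit Defensive.

Import Order.TTheory GRing.Theory Num.Theory.
Import numFieldNormedType.Exports.

(** * Sperner's lemma modulo 2 *)

(** The retraction is not equivariant and need not be: the rotation is applied after it, and since
    the composite takes values in X, its fixed point lies in X, where the retraction is the
    identity.

    The hypothesis speaks of maps on cubes, one degree at a time, while the retraction lives on
    simplices. A face with j + 1 vertices is therefore identified with the j-cube, boundary to
    boundary, so that triviality of pi_j contracts the face once its boundary is already sent to the
    base point. Homotopy extension allows these contractions to be undone at the end: whether a map
    from X to X extends to the full simplex depends only on its homotopy class, and the constant map
    extends.

    Counting modulo 2 lets simplices be plain lists of points, without orientations and without
    checking that a subdivision is a triangulation. The margin 1/q - 1/(q+1) is what absorbs
    g(p)/p. *)

Section Subdivision.
Variable T : eqType.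
Fixpoint facets (X : Type) (s : seq X) : seq (seq X) :=
  if s is x :: s' then s' :: [seq x :: u | u <- facets s'] else [::].

(** A list of simplices stands for a chain modulo 2. Chains are compared only through their pairings
    with arbitrary tests [E], so repeated simplices cancel without passing to a quotient. *)
Definition parity (X : Type) (c : seq X) (E : X -> bool) : bool :=
  \big[addb/false]_(x <- c) E x.

Lemma parity_nil X (E : X -> bool) : parity [::] E = false.
Proof. exact: big_nil. Qed.

Lemma parity_cons X x (c : seq X) (E : X -> bool) :
  parity (x :: c) E = E x (+) parity c E.
Proof. exact: big_cons. Qed.

Lemma parity_cat X (c d : seq X) (E : X -> bool) :
  parity (c ++ d) E = parity c E (+) parity d E.
Proof. exact: big_cat. Qed.

Lemma parity_map X Y (f : X -> Y) c (E : Y -> bool) :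
  parity (map f c) E = parity c (E \o f).
Proof. exact: big_map. Qed.

Lemma parity_flatten X (c : seq (seq X)) (E : X -> bool) :
  parity (flatten c) E = parity c (fun x => parity x E).
Proof.
elim: c => [|x c IHc]; first by rewrite !parity_nil.
by rewrite parity_cons parity_cat IHc.
Qed.

Lemma parity_addb X (c : seq X) (E F : X -> bool) :
  parity c (fun x => E x (+) F x) = parity c E (+) parity c F.
Proof. exact: big_split. Qed.

Lemma parity0 X (c : seq X) : parity c (fun=> false) = false.
Proof. exact: big1_eq. Qed.

Lemma eq_parity X (c : seq X) (E F : X -> bool) : E =1 F -> parity c E = parity c F.
Proof. by move=> EF; apply: eq_bigr => x _. Qed.

Lemma eq_in_parity (X : eqType) (c : seq X) (E F : X -> bool) :
  {in c, E =1 F} -> parity c E = parity c F.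
Proof. exact: eq_big_seq. Qed.

Lemma parity_has (X : eqType) (c : seq X) (E : X -> bool) :
  parity c E -> exists2 x, x \in c & E x.
Proof.
move=> cE; apply/hasP; apply/negPn/negP => /hasPn cE0.
by move: cE; rewrite (@eq_in_parity _ _ _ (fun=> false)) ?parity0// => x /cE0/negbTE.
Qed.

Lemma parity_facets_cons X (x : X) s (E : seq X -> bool) : parity (facets (x :: s)) E =
  E s (+) parity (facets s) (fun u => E (x :: u)).
Proof. by rewrite /= parity_cons parity_map. Qed.

Lemma facets_rcons X (s : seq X) x :
  facets (rcons s x) = rcons [seq rcons u x | u <- facets s] s.
Proof.
elim: s => //= y s ->; congr (_ :: _); rewrite map_rcons -!map_comp.
by congr rcons; apply: eq_map.
Qed.

Lemma facets_map X Y (f : X -> Y) s : facets (map f s) = map (map f) (facets s).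
Proof. by elim: s => //= x s ->; rewrite -!map_comp. Qed.

Lemma size_facets (s u : seq T) : u \in facets s -> size s = (size u).+1.
Proof.
elim: s u => //= x s IHs u; rewrite inE => /orP[/eqP-> //|/mapP[v vs ->]] /=.
by rewrite (IHs _ vs).
Qed.

Lemma sub_facets (s u : seq T) : u \in facets s -> {subset u <= s}.
Proof.
elim: s u => //= x s IHs u.
rewrite inE => /orP[/eqP-> y ys|/mapP[v vs ->] y]; rewrite !inE ?ys ?orbT//.
by case/orP=> [->//|/(IHs _ vs)->]; rewrite orbT.
Qed.

(** Two entries can be omitted in either order, so the terms cancel in pairs: the boundary of a
    boundary is zero modulo 2. *)
Lemma parity_facets_facets (s : seq T) (E : seq T -> bool) :
  parity (facets s) (fun u => parity (facets u) E) = false.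
Proof.
elim: s E => [|x s IHs] E; first exact: parity_nil.
rewrite parity_facets_cons (eq_parity _ (fun u => parity_facets_cons x u E)).
by rewrite parity_addb IHs addbF addbb.
Qed.

Variable b : seq T -> T.

(* The top simplices of the subdivision of [s]: the cone with apex [b s] over the
   subdivided boundary; [n] is fuel, meant to be [size s]. *)
Fixpoint sd_rec n s : seq (seq T) :=
  if n is n'.+1 then flatten [seq map (cons (b s)) (sd_rec n' u) | u <- facets s]
  else [:: [::]].

Definition sd s := sd_rec (size s) s.

Lemma sd_ind s : s != [::] ->
  sd s = flatten [seq map (cons (b s)) (sd u) | u <- facets s].
Proof.
case: s => // x s _; rewrite {1}/sd [size _]/= /=; congr (_ ++ flatten _).
apply/eq_in_map => u us; rewrite /sd (_ : size u = size s) //.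
by case/mapP: us => v /size_facets -> ->.
Qed.

Lemma parity_sd s E : s != [::] -> parity (sd s) E =
  parity (facets s) (fun u => parity (sd u) (fun t => E (b s :: t))).
Proof.
move=> s0; rewrite sd_ind // parity_flatten parity_map.
by apply: eq_parity => u /=; rewrite parity_map.
Qed.

(** Subdivision is a chain map. The facets of a cone [b s :: t] are its base [t] and the cones over
    the facets of [t]. The bases make up the subdivided boundary; by induction the cones make up the
    cone over the subdivided boundary of the boundary, which vanishes. *)
Lemma sd_boundary s E :
  parity (sd s) (fun t => parity (facets t) E) =
  parity (facets s) (fun u => parity (sd u) E).
Proof.
have [n] := ubnP (size s); elim: n s E => // n IHn s E sn.
have [->|s0] := eqVneq s [::].
  by rewrite /sd /= parity_cons !parity_nil.
rewrite parity_sd //.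
under eq_parity => u do
  (under eq_parity => t do rewrite parity_facets_cons; rewrite parity_addb).
rewrite parity_addb -[RHS]addbF; congr addb.
rewrite (@eq_in_parity _ _ _ (fun u => parity (facets u) (fun w =>
  parity (sd w) (fun t => E (b s :: t))))); first exact: parity_facets_facets.
by move=> u us; apply: IHn; rewrite -(size_facets us).
Qed.

Fixpoint isd m s : seq (seq T) :=
  if m is m'.+1 then flatten (map sd (isd m' s)) else [:: s].

Lemma isd_boundary m s E :
  parity (isd m s) (fun t => parity (facets t) E) =
  parity (facets s) (fun u => parity (isd m u) E).
Proof.
elim: m E => [|m IHm] E /=.
  rewrite parity_cons parity_nil addbF; apply: eq_parity => u.
  by rewrite parity_cons parity_nil addbF.
rewrite parity_flatten parity_map.
under eq_parity => u do rewrite /= sd_boundary.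
rewrite IHm; apply: eq_parity => u.
by rewrite parity_flatten parity_map.
Qed.

(** This serves for convex conditions: lying in the simplex, lying on a coordinate hyperplane, being
    close to a given point. *)
Lemma sd_closed (P : T -> Prop) s t :
    (forall u, u != [::] -> (forall x, x \in u -> P x) -> P (b u)) ->
  t \in sd s -> (forall x, x \in s -> P x) -> forall x, x \in t -> P x.
Proof.
move=> bP; have [n] := ubnP (size s); elim: n s t => // n IHn s t sn.
have [->|s0] := eqVneq s [::]; first by rewrite inE => /eqP->.
rewrite sd_ind // => /flatten_mapP[u us /mapP[v vu ->]] sP x.
rewrite inE => /orP[/eqP->|xv]; first exact: bP.
apply: (IHn u v) => //; first by rewrite -(size_facets us).
by move=> y /(sub_facets us); exact: sP.
Qed.

Lemma isd_closed (P : T -> Prop) m s t :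
    (forall u, u != [::] -> (forall x, x \in u -> P x) -> P (b u)) ->
  t \in isd m s -> (forall x, x \in s -> P x) -> forall x, x \in t -> P x.
Proof.
move=> bP; elim: m t => [|m IHm] t /=; first by rewrite inE => /eqP->.
case/flatten_mapP=> u um tu sP; apply: (sd_closed bP tu); exact: IHm.
Qed.

Lemma size_sd s t : t \in sd s -> size t = size s.
Proof.
have [n] := ubnP (size s); elim: n s t => // n IHn s t sn.
have [->|s0] := eqVneq s [::]; first by rewrite inE => /eqP->.
rewrite sd_ind // => /flatten_mapP[u us /mapP[v vu ->]] /=.
by rewrite (IHn u v) ?(size_facets us) // -ltnS -(size_facets us).
Qed.

Lemma size_isd m s t : t \in isd m s -> size t = size s.
Proof.
elim: m t => [|m IHm] t /=; first by rewrite inE => /eqP->.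
by case/flatten_mapP=> u /IHm <- /size_sd.
Qed.

End Subdivision.

(* A list obtained from [w ++ l] by omitting an entry of [l] is a permutation of
   [r] exactly when that entry is [a]; [w] is there for the induction. *)
Lemma parity_facets_perm_eq (T : eqType) (a : T) (r w l : seq T) :
  perm_eq (w ++ l) (a :: r) ->
  parity (facets l) (fun u => perm_eq (w ++ u) r) = odd (count_mem a l).
Proof.
elim: l w => [|x l IHl] w wl /=; first exact: parity_nil.
rewrite parity_cons parity_map oddD; congr addb.
- rewrite oddb; move: wl; rewrite -cat1s perm_catCA cat1s => wl.
  apply/idP/eqP => [wr|xa]; last by move: wl; rewrite xa perm_cons.
  have := perm_trans wl _; rewrite -(perm_cons x) in wr.
  have := perm_trans (_ : perm_eq (x :: r) (x :: w ++ l)) wl.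
  rewrite perm_sym => /(_ wr) /permP/(_ (pred1 x)) /=; rewrite eqxx.
  by case: eqP => // _ /addIn.
- rewrite -(IHl (rcons w x)) ?cat_rcons //.
  by apply: eq_parity => u; rewrite /= cat_rcons.
Qed.

Lemma perm_eq_facets (T : eqType) (l u : seq T) : u \in facets l ->
  exists x, x \in l /\ perm_eq l (x :: u).
Proof.
elim: l u => //= x l IHl u; rewrite inE => /orP[/eqP->|/mapP[v vl ->]].
  by exists x; rewrite mem_head.
have [y [yl lv]] := IHl _ vl; exists y; rewrite inE yl orbT; split=> //.
rewrite (perm_trans (_ : perm_eq _ (x :: y :: v))) ?perm_cons //.
by apply/permP => a /=; rewrite addnCA.
Qed.

(** If some facet is a door, that is, carries exactly the labels below [n], then [l] is a
    permutation of [a :: iota 0 n] for some [a], and the doors are counted by the multiplicity of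
    [a]: one if [a = n], two if [a < n]. *)
Lemma parity_doors n (l : seq nat) : all (gtn n.+1) l ->
  parity (facets l) (fun u => perm_eq u (iota 0 n)) = perm_eq l (iota 0 n.+1).
Proof.
move=> ln; have iotaE : perm_eq (iota 0 n.+1) (n :: iota 0 n).
  by rewrite -addn1 iotaD add0n /= cats1 perm_rcons.
have [ne|/hasPn ne] := boolP (has (fun u => perm_eq u (iota 0 n)) (facets l)).
  have {ne} [u ul un] := hasP ne; have [a [al lu]] := perm_eq_facets ul.
  have {lu}la : perm_eq l (a :: iota 0 n).
    by apply: perm_trans lu _; rewrite perm_cons.
  rewrite (parity_facets_perm_eq (w := [::]) la) (permP la) /= eqxx add1n /=.
  have := allP ln _ al; rewrite /= ltnS leq_eqVlt => /orP[/eqP an|an].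
    rewrite an in la *; rewrite (permPr iotaE) la.
    by rewrite count_uniq_mem ?iota_uniq // mem_iota add0n ltnn.
  rewrite count_uniq_mem ?iota_uniq // mem_iota an /=.
  apply/esym/negbTE/negP => /perm_uniq.
  by rewrite (perm_uniq la) (iota_uniq 0 n.+1) /= mem_iota an.
rewrite (@eq_in_parity _ _ _ (fun=> false)) ?parity0.
  apply/esym/negbTE/negP => ln1; have la := perm_trans ln1 iotaE.
  have := parity_facets_perm_eq (w := [::]) la; rewrite (permP la) /= eqxx.
  rewrite count_uniq_mem ?iota_uniq // mem_iota add0n ltnn /=.
  rewrite (@eq_in_parity _ _ _ (fun=> false)) ?parity0 //.
  by move=> u /ne /negbTE.
by move=> u /ne /negbTE.
Qed.

Lemma facets_iota n u : u \in facets (iota 0 n) ->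
  exists2 i, i < n & i \notin u.
Proof.
case/perm_eq_facets => i [ii iu]; exists i; first by rewrite mem_iota in ii.
by have := iota_uniq 0 n; rewrite (perm_uniq iu) => /andP[].
Qed.

(** * Rainbow simplices in iterated subdivisions *)

Section Sperner.
Variables (T : eqType) (b : seq T -> T) (N : nat) (e : nat -> T).
(** [D] abstracts the simplex, [avoid i] the hyperplane of the facet opposite to [e i], and
    [lam_avoid] is Sperner's condition on the labels. *)
Variables (D : T -> Prop) (avoid : nat -> T -> Prop) (lam : T -> nat).
Hypothesis D_b : forall u, u != [::] -> (forall x, x \in u -> D x) -> D (b u).
Hypothesis D_e : forall i, i < N -> D (e i).
Hypothesis avoid_b : forall i u,
  u != [::] -> (forall x, x \in u -> avoid i x) -> avoid i (b u).
Hypothesis avoid_e : forall i j, i < N -> j < N -> i <> j -> avoid i (e j).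
Hypothesis lam_lt : forall x, D x -> lam x < N.
Hypothesis lam_avoid : forall x, D x -> ~ avoid (lam x) x.

(** Induction on the dimension. The parity of rainbow cells is that of their doors; interior doors
    cancel by [isd_boundary], leaving those on the boundary. The facet opposite to the last vertex
    falls under the induction hypothesis, and any other facet misses some vertex [e i] with [i < n],
    so the label [i] does not occur on it. *)
Lemma sperner m n : n <= N ->
  parity (isd b m (map e (iota 0 n))) (fun t => perm_eq (map lam t) (iota 0 n)).
Proof.
elim: n => [|n IHn] nN.
  suff -> : isd b m [::] = [:: [::]] by rewrite parity_cons parity_nil.
  by elim: m => //= m ->.
have e_n1 : map e (iota 0 n.+1) = rcons (map e (iota 0 n)) (e n).
  by rewrite -addn1 iotaD map_cat add0n cats1.
have De s : {subset s <= iota 0 n.+1} -> forall x, x \in map e s -> D x.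
  move=> sn x /mapP[i /sn]; rewrite mem_iota /= => ilt ->.
  exact/D_e/(leq_trans ilt).
rewrite (@eq_in_parity _ _ _ (fun t =>
  parity (facets t) (fun u => perm_eq (map lam u) (iota 0 n)))); last first.
  move=> t te; rewrite -parity_doors ?facets_map ?parity_map //.
  apply/allP => _ /mapP[x xt ->] /=.
  have Dx : D x by apply: isd_closed te _ _ xt => //; apply: De.
  (* A label above [n] would name a vertex outside [e 0, ..., e n]; all of these avoid it, hence so
     does the whole subdivision. *)
  rewrite ltnNge; apply/negP => nlam; apply: (lam_avoid Dx).
  apply: (isd_closed (@avoid_b (lam x)) te) xt => y /mapP[i].
  rewrite mem_iota /= add0n => ilt ->.
  apply: avoid_e; [exact: lam_lt|exact: leq_trans nN|].
  by move=> li; rewrite -li ltnNge nlam in ilt.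
rewrite isd_boundary e_n1 facets_rcons -cats1 parity_cat parity_cons parity_nil.
rewrite addbF IHn ?(ltnW nN) // parity_map.
rewrite (@eq_in_parity _ _ _ (fun=> false)) ?parity0 // facets_map.
move=> _ /mapP[v vn ->] /=; have [i ilt iv] := facets_iota vn.
rewrite (@eq_in_parity _ _ _ (fun=> false)) ?parity0 // => t te.
apply/negbTE/negP => /perm_mem/(_ i); rewrite mem_iota ilt => /mapP[x xt li].
have De' : forall y, y \in rcons (map e v) (e n) -> D y.
  have -> : rcons (map e v) (e n) = map e (rcons v n) by rewrite map_rcons.
  apply: De => j; rewrite mem_rcons inE mem_iota /= => /orP[/eqP->//|/(sub_facets vn)].
  by rewrite mem_iota /= add0n => /ltnW.
apply: (@lam_avoid x); first exact: isd_closed te De' _ xt.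
rewrite -li; apply: (isd_closed (@avoid_b i) te) xt => y.
rewrite -map_rcons => /mapP[j]; rewrite mem_rcons inE => jv ->.
have [jn ij] : j <= n /\ i <> j.
  move: jv => /orP[/eqP->|jv]; first by split=> // ni; rewrite ni ltnn in ilt.
  split; last by move=> ij; rewrite ij jv in iv.
  by have := sub_facets vn jv; rewrite mem_iota /= => /ltnW.
by apply: avoid_e => //; [exact: ltn_trans ilt nN|exact: leq_ltn_trans nN].
Qed.
End Sperner.

Local Open Scope classical_set_scope.
Local Open Scope ring_scope.

(** * Continuity on subsets *)

Section Continuity.
Variable R : realType.

Lemma cvg_row (T : Type) (F : set_system T) (n : nat) (f : T -> 'rV[R]_n) (l : 'rV[R]_n) :
  Filter F -> (forall i, f x ord0 i @[x --> F] --> l ord0 i) ->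
  f x @[x --> F] --> l.
Proof.
move=> FF fl; apply/cvg_ballP => e e0.
have : \forall x \near F, forall i, ball (l ord0 i) e (f x ord0 i).
  by apply: filter_forall => i; move/cvg_ballP: (fl i) => /(_ _ e0).
by apply: filterS => x fx; split=> // i j; rewrite ord1.
Qed.

Lemma continuous_row (T : topologicalType) (n : nat) (f : T -> 'rV[R]_n) :
  (forall i, continuous (fun x => f x ord0 i)) -> continuous f.
Proof. by move=> cf x; apply: cvg_row => i; exact: cf. Qed.

Lemma continuous_rowE (T : topologicalType) (n : nat) (f : T -> 'rV[R]_n) i :
  continuous f -> continuous (fun x => f x ord0 i).
Proof.
move=> cf x; apply: (@continuous_comp _ _ _ f (fun y => y ord0 i)); first exact: cf.
exact: coord_continuous.
Qed.

Lemma within_continuousP (T U : topologicalType) (A : set T) (f : T -> U) :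
  {within A, continuous f} <->
  forall x, A x -> f y @[y --> within A (nbhs x)] --> f x.
Proof. exact: subspace_continuousP. Qed.

Lemma within_continuous_comp_in {T U V : topologicalType} {A : set T} {B : set U}
    {f : T -> U} {g : U -> V} :
  (forall x, A x -> B (f x)) -> {within A, continuous f} ->
  {within B, continuous g} -> {within A, continuous (g \o f)}.
Proof.
move=> AB /within_continuousP cf /within_continuousP cg.
apply/within_continuousP => x Ax; apply: cvg_comp (cg _ (AB _ Ax)).
move=> W; rewrite /= !nbhs_simpl /= => BW.
have := cf x Ax _ BW; rewrite !nbhs_simpl /= /within /=.
by apply: filterS => y Wfy Ay; apply: Wfy (AB _ Ay).
Qed.

Lemma within_continuous_pair (T U V : topologicalType) (A : set T)
    (f : T -> U) (g : T -> V) :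
  {within A, continuous f} -> {within A, continuous g} ->
  {within A, continuous (fun x => (f x, g x))}.
Proof. by move=> cf cg x; apply: cvg_pair; [exact: cf|exact: cg]. Qed.

Lemma eq_within_continuous (T U : topologicalType) (A : set T) (f g : T -> U) :
  (forall x, A x -> f x = g x) -> {within A, continuous f} ->
  {within A, continuous g}.
Proof. by move=> fg; apply: subspace_eq_continuous => x /set_mem /fg. Qed.

Lemma continuous_sum (T : topologicalType) (I : finType) (f : I -> T -> R) :
  (forall i, continuous (f i)) -> continuous (fun x => \sum_i f i x).
Proof. by move=> cf; apply: continuous_big => //; exact: add_continuous. Qed.

Lemma continuous_bigmax (T : topologicalType) (I : finType) (P : pred I) (a : R)
    (f : I -> T -> R) : (forall i, continuous (f i)) ->
  continuous (fun x => \big[Num.max/a]_(i | P i) f i x).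
Proof.
move=> cf; apply: continuous_big => // z.
exact: (@continuous_max _ _ fst snd z cvg_fst cvg_snd).
Qed.

Lemma continuous_bigmin (T : topologicalType) (I : finType) (P : pred I) (a : R)
    (f : I -> T -> R) : (forall i, continuous (f i)) ->
  continuous (fun x => \big[Num.min/a]_(i | P i) f i x).
Proof.
move=> cf; apply: continuous_big => // z.
exact: (@continuous_min _ _ fst snd z cvg_fst cvg_snd).
Qed.

(* Division by zero yields 0, which is also the limit at the zeros of [w]. *)
Lemma within_continuous_ratio (T : topologicalType) (A : set T) (c : R)
    (u v w : T -> R) :
  {within A, continuous u} -> {within A, continuous v} ->
  {within A, continuous w} -> (forall x, A x -> `|v x| <= c * `|w x|) ->
  (forall x, A x -> w x = 0 -> u x = 0) ->
  {within A, continuous (fun x => u x * (v x / w x))}.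
Proof.
move=> /within_continuousP cu /within_continuousP cv /within_continuousP cw.
move=> vw wu; apply/within_continuousP => x Ax.
have [wx|wx] := eqVneq (w x) 0.
  rewrite wx invr0 !mulr0; apply: norm_cvg0.
  apply: (@squeeze_cvgr _ _ _ _ (fun=> 0) (fun y => `|u y| * `|c|)).
  - near=> y; have Ay : A y by near: y; exact: withinT.
    rewrite normr_ge0 /= normrM ler_wpM2l // normrM normfV.
    have [->|wy] := eqVneq (w y) 0; first by rewrite normr0 invr0 mulr0.
    rewrite ler_pdivrMr ?normr_gt0 //.
    by rewrite (le_trans (vw y Ay)) // ler_wpM2r // ler_norm.
  - exact: cvg_cst.
  - rewrite -(mul0r `|c|) -(normr0 R) -(wu _ Ax wx).
    by apply: cvgM; [apply: cvg_norm; exact: cu|exact: cvg_cst].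
by apply: cvgM; [exact: cu|apply: cvgM; [exact: cv|apply: cvgV wx _; exact: cw]].
Unshelve. all: by end_near. Qed.

Lemma closed_le_fun (T : topologicalType) (f g : T -> R) :
  continuous f -> continuous g -> closed [set x | f x <= g x].
Proof.
move=> cf cg; rewrite (_ : [set x | _] = (fun x => g x - f x) @^-1` [set y | 0 <= y]).
  by apply: preimage_closed => [x _|];
    [apply: cvgB; [exact: cg|exact: cf]|exact: closed_ge].
by apply/seteqP; split=> x /=; rewrite subr_ge0.
Qed.

End Continuity.

(** * Brouwer's fixed point theorem on the simplex *)

Section StandardSimplex.
Variable R : realType.

Definition std_simplex (n : nat) : set 'rV[R]_n :=
  [set x | (forall i, 0 <= x ord0 i) /\ \sum_i x ord0 i = 1].

Lemma std_simplex_le1 n (x : 'rV[R]_n) i : @std_simplex n x -> x ord0 i <= 1.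
Proof.
move=> [x0 <-]; rewrite (bigD1 i) //= lerDl; exact: sumr_ge0.
Qed.

Lemma closed_std_simplex n : closed (@std_simplex n).
Proof.
rewrite (_ : @std_simplex n = (\bigcap_i [set x | 0 <= x ord0 i]) `&`
    ([set x | \sum_i x ord0 i <= 1] `&` [set x | 1 <= \sum_i x ord0 i])).
  have csum : continuous (fun x : 'rV[R]_n => \sum_i x ord0 i).
    by apply: continuous_sum => i; exact: coord_continuous.
  have ccst (a : R) : continuous (cst a : 'rV[R]_n -> R) by exact: cst_continuous.
  apply: closedI; last apply: closedI.
  - apply: closed_bigI => i _.
    exact: (closed_le_fun (ccst 0) (@coord_continuous _ _ _ ord0 i)).
  - exact: (closed_le_fun csum (ccst 1)).
  - exact: (closed_le_fun (ccst 1) csum).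
apply/seteqP; split=> x /=.
  by move=> [x0 x1]; split; [move=> i _; exact: x0|rewrite x1].
move=> [x0 /andP x1]; split; first by move=> i; exact: x0.
exact/le_anti.
Qed.

Lemma compact_std_simplex n : compact (@std_simplex n).
Proof.
apply: (@subclosed_compact _ _
  [set v : 'rV[R]_n | forall i, [set` `[0 : R, 1]] (v ord0 i)]).
- exact: closed_std_simplex.
- exact: (@rV_compact R n (fun=> [set` `[0 : R, 1]]) (fun=> @segment_compact R 0 1)).
- by move=> x xs i /=; rewrite in_itv /= std_simplex_le1 // xs.1.
Qed.

(** * Barycentric subdivision and its mesh *)

Definition barycenter (n : nat) (s : seq 'rV[R]_n) : 'rV[R]_n :=
  (size s)%:R^-1 *: \sum_(x <- s) x.

Lemma barycenterE n (s : seq 'rV[R]_n) i :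
  barycenter s ord0 i = (size s)%:R^-1 * \sum_(x <- s) x ord0 i.
Proof. by rewrite mxE summxE. Qed.

Lemma barycenter_cst n (s : seq 'rV[R]_n) (f : 'rV[R]_n -> R) (a : R) :
  s != [::] -> (forall x, x \in s -> f x = a) ->
  (size s)%:R^-1 * \sum_(x <- s) f x = a.
Proof.
move=> s0 fa; rewrite (eq_big_seq (fun=> a)) // big_const_seq count_predT.
by rewrite iter_addr_0 -[a *+ _]mulr_natl mulrA mulVf ?mul1r // pnatr_eq0 size_eq0.
Qed.

Lemma barycenter_std_simplex n (s : seq 'rV[R]_n) : s != [::] ->
  (forall x, x \in s -> @std_simplex n x) -> @std_simplex n (barycenter s).
Proof.
move=> s0 sD; split=> [i|].
  rewrite barycenterE mulr_ge0 ?invr_ge0 // big_seq sumr_ge0 // => x /sD[x0 _].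
  exact: x0.
under eq_bigr do rewrite barycenterE.
rewrite -mulr_sumr exchange_big /=; apply: barycenter_cst => // x /sD[].
by [].
Qed.

Lemma sum_le_size (T : eqType) (s : seq T) (f : T -> R) (r : R) :
  (forall x, x \in s -> f x <= r) -> \sum_(x <- s) f x <= (size s)%:R * r.
Proof.
elim: s => [|x s IHs] sr; first by rewrite big_nil mul0r.
rewrite big_cons -natr1 mulrDl mul1r addrC lerD ?sr ?mem_head ?IHs// => y ys.
by rewrite sr // inE ys orbT.
Qed.

Lemma barycenter_dist n (s : seq 'rV[R]_n) i (a r : R) : s != [::] ->
  (forall x, x \in s -> `|a - x ord0 i| <= r) -> `|a - barycenter s ord0 i| <= r.
Proof.
move=> s0 sr; have n0 : (size s)%:R != 0 :> R by rewrite pnatr_eq0 size_eq0.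
rewrite -(@barycenter_cst _ s (fun=> a) a) // barycenterE -mulrBr -sumrB.
rewrite normrM ger0_norm ?invr_ge0 // mulrC ler_pdivrMr ?lt0r ?n0 ?ler0n//.
by rewrite (le_trans (ler_norm_sum _ _ _)) // mulrC sum_le_size.
Qed.

(** In the average of the differences to [x] the term of [x] itself is zero, which leaves
    [size s - 1] terms out of [size s]. The bound [N] makes the factor uniform over all faces. *)
Lemma barycenter_vertex_dist n N (s : seq 'rV[R]_n) i (r : R) x : (size s <= N)%N ->
  (forall x y, x \in s -> y \in s -> `|x ord0 i - y ord0 i| <= r) ->
  x \in s -> `|barycenter s ord0 i - x ord0 i| <= (1 - N%:R^-1) * r.
Proof.
move=> sN sr xs; have s0 : s != [::] by case: (s) xs.
have n0 : (size s)%:R != 0 :> R by rewrite pnatr_eq0 size_eq0.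
have r0 : 0 <= r by rewrite (le_trans _ (sr x x xs xs)).
have sp : 0 < (size s)%:R :> R by rewrite lt0r n0 ler0n.
rewrite -[x ord0 i](@barycenter_cst _ s (fun=> x ord0 i)) //.
rewrite barycenterE -mulrBr -sumrB (perm_big _ (perm_to_rem xs)) /= big_cons subrr add0r.
rewrite normrM ger0_norm ?invr_ge0 //.
rewrite (@le_trans _ _ ((1 - (size s)%:R^-1) * r)) //; last first.
  rewrite ler_wpM2r // lerD2l lerN2 lef_pV2 ?posrE ?ler_nat //.
  by rewrite (lt_le_trans sp) // ler_nat.
rewrite mulrC ler_pdivrMr // mulrAC mulrBl mul1r mulVf //.
rewrite (le_trans (ler_norm_sum _ _ _)) //.
rewrite (le_trans (sum_le_size (r := r) _)) //.
  by move=> y /mem_rem ys; apply: sr.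
rewrite size_rem // ler_wpM2r // -subn1 natrB ?lt0n ?size_eq0 //.
Qed.

(** An edge of the subdivision either leaves the apex, and then convexity reduces it to the distance
    from the barycenter to a vertex of [s], or it lies in a subdivided facet, where induction
    applies. *)
Lemma sd_mesh n N (s t : seq 'rV[R]_n) i (r : R) : (size s <= N)%N ->
  (forall x y, x \in s -> y \in s -> `|x ord0 i - y ord0 i| <= r) ->
  t \in sd (@barycenter n) s ->
  forall x y, x \in t -> y \in t -> `|x ord0 i - y ord0 i| <= (1 - N%:R^-1) * r.
Proof.
have [k] := ubnP (size s); elim: k s t => // k IHk s t sk sN sr.
have [->|s0] := eqVneq s [::]; first by rewrite inE => /eqP->.
rewrite sd_ind // => /flatten_mapP[u us /mapP[v vu ->]].
have bv y : y \in v -> `|barycenter s ord0 i - y ord0 i| <= (1 - N%:R^-1) * r.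
  move: y; apply: (sd_closed _ vu) => [w w0|y ys].
    exact: barycenter_dist.
  apply: barycenter_vertex_dist => //; exact: sub_facets us _ ys.
have c0 : 0 <= (1 - N%:R^-1) * r.
  case: (s) s0 sr sN => // z s' _ sr sN.
  rewrite mulr_ge0 // ?subr_ge0 ?invf_le1 ?ler1n ?ltr0n ?(leq_trans _ sN) //.
  by rewrite (le_trans _ (sr z z _ _)) ?mem_head.
move=> x y; rewrite !inE => /orP[/eqP->|xv] /orP[/eqP->|yv].
- by rewrite subrr normr0.
- exact: bv.
- by rewrite distrC; exact: bv.
- apply: IHk vu _ _ xv yv => //.
  + by rewrite -(size_facets us).
  + by rewrite (leq_trans _ sN) // (size_facets us).
  + by move=> a c au cu; apply: sr; apply: sub_facets us _ _.
Qed.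

Lemma isd_mesh n N m (s t : seq 'rV[R]_n) i (r : R) : (size s <= N)%N ->
  (forall x y, x \in s -> y \in s -> `|x ord0 i - y ord0 i| <= r) ->
  t \in isd (@barycenter n) m s ->
  forall x y, x \in t -> y \in t -> `|x ord0 i - y ord0 i| <= (1 - N%:R^-1) ^+ m * r.
Proof.
move=> sN sr; elim: m t => [|m IHm] t /=.
  by rewrite inE mul1r => /eqP->.
case/flatten_mapP=> u um; rewrite exprS -mulrA; apply: sd_mesh; last exact: IHm.
by rewrite (size_isd um).
Qed.

End StandardSimplex.

(** * From rainbow cells to a fixed point *)

Section Brouwer.
Variables (R : realType) (n : nat) (G : 'rV[R]_n.+1 -> 'rV[R]_n.+1).
Notation simplex := (@std_simplex R n.+1).
Hypothesis simplexG : forall x, simplex x -> simplex (G x).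

(** Positivity of the chosen coordinate makes this a Sperner labelling; the default [ord0] never
    occurs on the simplex, by [labelP]. *)
Let label (x : 'rV[R]_n.+1) : nat :=
  odflt ord0 [pick i | (0 < x ord0 i) && (G x ord0 i <= x ord0 i)].

(** Otherwise [G] strictly increases every positive coordinate and decreases none, although the
    coordinates of [x] and of [G x] have the same sum 1. *)
Let labelP x : simplex x -> let i := inord (label x) in
  0 < x ord0 i /\ G x ord0 i <= x ord0 i.
Proof.
move=> Dx; rewrite /label; case: pickP => [i /andP[]|none] /=.
  by rewrite inord_val.
have [x0 x1] := Dx; have [Gx0 Gx1] := simplexG Dx.
have le i : x ord0 i <= G x ord0 i.
  have := none i; rewrite lt0r x0 andbT.
  by have [->//|_ /=] := eqVneq (x ord0 i) 0; rewrite leNgt => /negbFE/ltW.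
have eq0 i : x ord0 i = 0.
  apply/eqP; apply/negPn/negP => xi0; have := none i.
  rewrite lt0r xi0 x0 /= => /negbT; rewrite -ltNge => lti.
  suff : \sum_i x ord0 i < \sum_i G x ord0 i by rewrite x1 Gx1 ltxx.
  rewrite (bigD1 i) //= [ltRHS](bigD1 i) //= ltr_leD // ler_sum //.
by move: x1; rewrite big1 // => /esym/eqP; rewrite oner_eq0.
Qed.

Let vertex (i : nat) : 'rV[R]_n.+1 := delta_mx ord0 (inord i).

Let rainbow m : exists s : seq 'rV[R]_n.+1,
  [/\ forall x, x \in s -> simplex x,
      forall x y i, x \in s -> y \in s ->
        `|x ord0 i - y ord0 i| <= (1 - n.+1%:R^-1) ^+ m &
      forall i, exists2 x, x \in s & G x ord0 i <= x ord0 i].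
Proof.
have vertexP i : simplex (vertex i).
  split=> [j|]; first by rewrite mxE; case: (_ && _).
  rewrite (bigD1 (inord i)) //= big1 ?addr0 => [|j ji]; first by rewrite mxE !eqxx.
  by rewrite mxE eqxx (negbTE ji).
pose avoid (i : nat) (x : 'rV[R]_n.+1) := x ord0 (inord i) = 0.
have bavoid i u : u != [::] -> (forall x, x \in u -> avoid i x) ->
    avoid i (barycenter u).
  by move=> u0 ua; rewrite /avoid barycenterE; apply: barycenter_cst.
have [t tm tl] : exists2 t,
    t \in isd (@barycenter R n.+1) m (map vertex (iota 0 n.+1)) &
    perm_eq (map label t) (iota 0 n.+1).
  apply: parity_has; apply: (@sperner _ _ n.+1 vertex simplex avoid) => //.
  - exact: barycenter_std_simplex.
  - move=> i j ilt jlt ij; rewrite /avoid mxE eqxx /= (_ : _ == _ = false) //.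
    by apply/eqP => /(congr1 (@nat_of_ord _)); rewrite !inordK.
  - by move=> x _; exact: ltn_ord.
  - by move=> x Dx avx; have [] := labelP Dx; rewrite avx ltxx.
have tD x : x \in t -> simplex x.
  apply: isd_closed tm _ x; first exact: barycenter_std_simplex.
  by move=> x /mapP[i _ ->].
exists t; split=> // [x y i xt yt|i].
  rewrite -[X in _ <= X]mulr1; apply: isd_mesh tm _ _ xt yt.
    by rewrite size_map size_iota.
  move=> _ _ /mapP[j _ ->] /mapP[k _ ->].
  rewrite !mxE; case: (_ && _); case: (_ && _);
    by rewrite ?subrr ?subr0 ?sub0r ?normrN ?normr0 ?normr1.
have : val i \in iota 0 n.+1 by rewrite mem_iota /= ltn_ord.
rewrite -(perm_mem tl) => /mapP[x xt il]; exists x => //.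
by have [_] := labelP (tD _ xt); rewrite -il inord_val.
Qed.

(** Rainbow cells of finer and finer subdivisions accumulate at a point [x]. Each coordinate has a
    vertex near [x] at which [G] does not increase it, so in the limit [G x] is at most [x] in every
    coordinate; equal sums force equality. *)
Theorem brouwer : {within simplex, continuous G} ->
  exists2 x, simplex x & G x = x.
Proof.
move=> /within_continuousP cG.
have [s sP] := choice rainbow.
pose v m := head 0 (s m).
have vs m : v m \in s m.
  have [_ _ /(_ ord0)[x xs _]] := sP m.
  by rewrite /v; case: (s m) xs => //= y s' _; exact: mem_head.
have [x [Dx cx]] : simplex `&` cluster (v @ \oo) !=set0.
  apply: compact_std_simplex.
  by exists 0%N => // m _; have [+ _ _] := sP m; apply.
exists x => //.
have le i : G x ord0 i <= x ord0 i.
  rewrite leNgt; apply/negP => lti.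
  have : \forall y \near within simplex (nbhs x), 0 < G y ord0 i - y ord0 i.
    have : G y ord0 i - y ord0 i @[y --> within simplex (nbhs x)] -->
        G x ord0 i - x ord0 i.
      apply: cvgB; last by apply: cvg_within_filter; exact: coord_continuous.
      apply: (@cvg_comp _ _ _ G (fun y => y ord0 i)); first exact: cG.
      exact: coord_continuous.
    by move/cvgr_gt; apply; rewrite subr_gt0.
  rewrite near_withinE => /nbhs_ballP[e /= e0 xe].
  have e20 : 0 < e / 2 by rewrite divr_gt0.
  have [M _ Mlt] : \forall m \near \oo, (1 - n.+1%:R^-1 : R) ^+ m < e / 2.
    have : `|1 - n.+1%:R^-1 : R| < 1.
      rewrite ger0_norm ?ltrBlDr ?ltrDl ?invr_gt0 ?ltr0n //.
      by rewrite subr_ge0 invf_le1 ?ler1n ?ltr0n.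
    by move=> /cvg_expr/cvgr_lt; apply.
  have [y [[m Mm <-] xy]] :
      [set v m | m in [set m | (M <= m)%N]] `&` ball x (e / 2) !=set0.
    apply: cx; last exact: nbhsx_ballx.
    by exists M => // m /= Mm; exists m.
  have [sD smesh /(_ i)[z zs]] := sP m.
  rewrite -subr_le0 leNgt => /negP; apply; apply: xe; last exact: sD.
  split=> // j k; rewrite ord1 (splitr e); apply: ball_triangle (xy.2 ord0 k) _.
  rewrite /ball /= (le_lt_trans (smesh _ _ _ _ zs)) //; exact: Mlt.
apply/rowP => i; apply/esym/eqP; rewrite -subr_eq0; apply/eqP.
apply: (psumr_eq0P (P := xpredT) (F := fun i => x ord0 i - G x ord0 i)) => //.
  by move=> j _; rewrite subr_ge0.
by rewrite sumrB Dx.2 (simplexG Dx).2 subrr.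
Unshelve. all: by end_near. Qed.
End Brouwer.

(** * Homotopy extension for subcomplexes *)

Section HomotopyExtension.
Variables (R : realType) (p : nat).
Implicit Types (S : {set {set 'I_p}}) (x : 'rV[R]_p) (c : R).

(** Unlike in [simplicial_complex], some vertices may be missing; this covers a single closed face
    and the complex whose only face is empty. *)
Definition face_closed S :=
  finset.set0 \in S /\ forall s t : {set 'I_p}, s \in S -> t \subset s -> t \in S.

Definition supp x : {set 'I_p} := [set i | x ord0 i != 0]%SET.

Lemma realizationE S x :
  realization R S x <-> std_simplex x /\ supp x \in S.
Proof. by split=> [[]|[[]]]. Qed.

Definition largest x := \big[Num.max/0]_i x ord0 i.

(* Vanishes exactly on the realization of [S], and the vertices where [x] exceeds
   it always span a face of [S]. *)
Definition gap S x :=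
  \big[Num.max/0]_(s : {set 'I_p} | s \notin S) \big[Num.min/1]_(i in s) x ord0 i.

Lemma gap_ge0 S x : 0 <= gap S x. Proof. exact: bigmax_ge_id. Qed.

Lemma le_largest x i : x ord0 i <= largest x. Proof. exact: le_bigmax. Qed.

Lemma gap0_realization S x : std_simplex x -> gap S x <= 0 -> realization R S x.
Proof.
move=> xD /bigmax_leP[_ x0]; apply/realizationE; split=> //.
apply/negPn/negP => /x0; apply/negP; rewrite -ltNge; apply/bigmin_gtP; split=> // i.
by rewrite inE lt0r => ->; exact: xD.1.
Qed.

Lemma realization_gap0 S x : face_closed S -> realization R S x -> gap S x = 0.
Proof.
move=> [_ SD] /realizationE[xD xS]; apply/eqP; rewrite eq_le gap_ge0 andbT.
apply/bigmax_leP; split=> // s sS; apply/bigmin_leP; right.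
have /fintype.subsetPn[i si xi] : ~~ (s \subset supp x).
  by apply: contra sS; exact: SD.
by exists i => //; move: xi; rewrite inE negbK => /eqP->.
Qed.

(** Were this set not a face, the minimum of [x] over it would be among the values whose maximum is
    [gap S x], yet it exceeds that maximum. *)
Lemma super_gap_face S x : face_closed S -> std_simplex x ->
  [set i | gap S x < x ord0 i]%SET \in S.
Proof.
move=> [S0 _] xD; apply/negPn/negP => sS.
set s := [set i | _]%SET in sS.
(* A member [j] gives [gap S x < x_j <= 1], which is needed to beat the base value 1 of the
   minimum. *)
have /finset.set0Pn[j] : s != finset.set0 by apply: contra sS => /eqP->.
rewrite inE => js.
have : gap S x < \big[Num.min/1]_(i in s) x ord0 i.
  apply/bigmin_gtP; split=> [|i]; last by rewrite inE.
  exact: lt_le_trans js (std_simplex_le1 _ xD).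
by rewrite ltNge le_bigmax_cond.
Qed.

Lemma largest_gt0 x : std_simplex x -> 0 < largest x.
Proof.
move=> [x0 x1]; rewrite ltNge; apply/negP => /bigmax_leP[_ xle].
move: x1; rewrite big1 => [/esym/eqP|i _]; first by rewrite oner_eq0.
by apply/le_anti; rewrite xle ?x0.
Qed.

Lemma continuous_largest : continuous largest.
Proof. by apply: continuous_bigmax => i; exact: coord_continuous. Qed.

Lemma continuous_gap S : continuous (gap S).
Proof.
apply: continuous_bigmax => s; apply: continuous_bigmin => i.
exact: coord_continuous.
Qed.

Lemma closed_realization S : face_closed S -> closed (realization R S).
Proof.
move=> SD; rewrite (_ : realization R S =
    @std_simplex R p `&` [set x | gap S x <= cst 0 x]).
  apply: closedI; first exact: closed_std_simplex.
  by apply: closed_le_fun; [exact: continuous_gap|exact: cst_continuous].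
apply/seteqP; split=> x.
  by move=> xS; split; [case/realizationE: xS|rewrite /= realization_gap0].
by case=> xD /=; exact: gap0_realization.
Qed.

(** Truncation at height [c], then renormalisation. As [c] grows from 0 to [gap S' x], the point
    moves from [x] to the realization of [S']. *)
Definition squash c x : 'rV[R]_p :=
  \row_i (Num.max 0 (x ord0 i - c) / \sum_k Num.max 0 (x ord0 k - c)).

Lemma squash_den_gt0 c x : 0 <= c < largest x ->
  0 < \sum_k Num.max 0 (x ord0 k - c).
Proof.
move=> /andP[c0 /bigmax_gtP[|[i _ ci]]]; first by rewrite ltNge c0.
rewrite (bigD1 i) //= ltr_wpDr ?sumr_ge0 // => [k _|]; first by rewrite le_max lexx.
by rewrite lt_max subr_gt0 ci orbT.
Qed.

Lemma squash_simplex c x : 0 <= c < largest x -> std_simplex (squash c x).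
Proof.
move=> /squash_den_gt0 den; split=> [i|].
  by rewrite mxE divr_ge0 // ?le_max ?lexx // ltW.
by under eq_bigr do rewrite mxE; rewrite -mulr_suml divff // gt_eqF.
Qed.

Lemma supp_squash c x : 0 <= c < largest x ->
  supp (squash c x) = [set i | c < x ord0 i]%SET.
Proof.
move=> /squash_den_gt0 den; apply/setP => i; rewrite !inE mxE mulf_eq0 invr_eq0.
rewrite (gt_eqF den) orbF; have [ci|ci] := ltP c (x ord0 i).
  by rewrite gt_eqF // lt_max subr_gt0 ci orbT.
by rewrite max_l ?eqxx // subr_le0.
Qed.

Lemma squash0 x : std_simplex x -> squash 0 x = x.
Proof.
move=> [x0 x1]; apply/rowP => i; rewrite mxE.
under eq_bigr do rewrite subr0 max_r //.
by rewrite x1 divr1 subr0 max_r.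
Qed.

Lemma within_continuous_squash (T : topologicalType) (A : set T) (f : T -> R) :
  forall g : T -> 'rV[R]_p,
  {within A, continuous f} -> {within A, continuous g} ->
  (forall z, A z -> 0 <= f z < largest (g z)) ->
  {within A, continuous (fun z => squash (f z) (g z))}.
Proof.
move=> g cf cg fg; apply: continuous_row => i.
have cmax k : {within A, continuous (fun z => Num.max 0 (g z ord0 k - f z))}.
  move=> z; apply: (@continuous_max R (subspace A) (cst 0) (fun z => g z ord0 k - f z) z).
    exact: cst_continuous.
  by apply: continuousB; [exact: continuous_rowE cg z|exact: cf].
have csum := continuous_sum cmax.
apply: (@eq_within_continuous _ _ _ (fun z =>
  Num.max 0 (g z ord0 i - f z) / \sum_k Num.max 0 (g z ord0 k - f z))).
  by move=> z _; rewrite mxE.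
apply/within_continuousP => z Az.
apply: cvgM; first by move/within_continuousP: (cmax i); exact.
apply: cvgV; first by rewrite gt_eqF // squash_den_gt0 // fg.
by move/within_continuousP: csum; exact.
Qed.

Lemma squash_realization S c x : face_closed S -> 0 <= c < largest x ->
  realization R S x -> realization R S (squash c x).
Proof.
move=> [_ SD] cx /realizationE[[x0 _] xS]; apply/realizationE.
split; first exact: squash_simplex.
apply: SD xS _; rewrite supp_squash //; apply/fintype.subsetP => i; rewrite !inE => ci.
by rewrite gt_eqF // (le_lt_trans _ ci) //; case/andP: cx.
Qed.

Lemma closed_cylinder (A : set 'rV[R]_p) : closed A -> closed (A `*` `[0 : R, 1]).
Proof.
move=> cA; rewrite (_ : _ `*` _ = (fst @^-1` A) `&` (snd @^-1` `[0 : R, 1])) //.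
apply: closedI; apply: preimage_closed => //.
- by move=> z _; exact: cvg_fst.
- by move=> z _; exact: cvg_snd.
- exact: interval_closed.
Qed.

Lemma homotopy_extension S' S (T : topologicalType) (Y : set T)
    (F : 'rV[R]_p -> T) (h : 'rV[R]_p * R -> T) :
  face_closed S' -> face_closed S -> S' \subset S ->
  {within realization R S, continuous F} ->
  (forall x, realization R S x -> Y (F x)) ->
  {within realization R S' `*` `[0, 1], continuous h} ->
  (forall x t, realization R S' x -> 0 <= t <= 1 -> Y (h (x, t))) ->
  (forall x, realization R S' x -> h (x, 0) = F x) ->
  exists H : 'rV[R]_p * R -> T,
    [/\ {within realization R S `*` `[0, 1], continuous H},
        forall x t, realization R S x -> 0 <= t <= 1 -> Y (H (x, t)),
        forall x, realization R S x -> H (x, 0) = F x &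
        forall x t, realization R S' x -> 0 <= t <= 1 -> H (x, t) = h (x, t)].
Proof.
move=> S'D SD S'S cF FY ch hY hF.
(* At time [t] a point with [2 gap x <= t largest x] has been pushed onto the
   realization of [S'] and has followed [h] during the remaining time
   [t - 2 gap x / largest x]; every other point has only been pushed towards it. *)
pose c (z : 'rV[R]_p * R) := Num.min (gap S' z.1) (z.2 * largest z.1 / 2).
pose k z := squash (c z) z.1.
pose tau (z : 'rV[R]_p * R) := z.2 - 2 * gap S' z.1 / largest z.1.
pose H z := if 2 * gap S' z.1 <= z.2 * largest z.1 then h (k z, tau z) else F (k z).
set D := realization R S `*` `[0, 1].
have DE z : D z -> [/\ realization R S z.1, 0 <= z.2, z.2 <= 1 & 0 < largest z.1].
  move=> [zS]; rewrite /= in_itv /= => /andP[z0 z1]; split=> //.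
  by apply: largest_gt0; case/realizationE: zS.
(* The factor 1/2 in [c] keeps the truncation height strictly below the largest coordinate even at
   time 1, so that [squash] never divides by zero. *)
have Dc z : D z -> 0 <= c z < largest z.1.
  case/DE=> zS z0 z1 l0; rewrite le_min gap_ge0 /= gt_min.
  rewrite mulr_ge0 ?mulr_ge0 ?(ltW l0) //=; apply/orP; right.
  by rewrite ltr_pdivrMr // (le_lt_trans (_ : _ <= 1 * largest z.1)) //;
    [rewrite ler_wpM2r // ltW|nra].
have kS z : D z -> realization R S (k z).
  by move=> Dz; apply: squash_realization (Dc _ Dz) _ => //; case: (DE _ Dz).
have near_kS z : D z -> 2 * gap S' z.1 <= z.2 * largest z.1 ->
    realization R S' (k z) /\ 0 <= tau z <= 1.
  move=> Dz zle; have [zS z0 z1 l0] := DE _ Dz.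
  have cE : c z = gap S' z.1 by rewrite /c min_l //; lra.
  split.
    have := Dc _ Dz; rewrite /k cE => cz; apply/realizationE.
    split; first exact: squash_simplex.
    by rewrite supp_squash //; apply: super_gap_face => //; case/realizationE: zS.
  rewrite /tau subr_ge0 ler_pdivrMr // zle lerBlDr (le_trans z1) // lerDl.
  by rewrite divr_ge0 ?mulr_ge0 ?gap_ge0 ?(ltW l0).
have k0 z : D z -> c z = 0 -> k z = z.1.
  by move=> /DE[/realizationE[zD _] _ _ _] cz; rewrite /k cz squash0.
exists H; split=> [|x t xS t01|x xS|x t xS' t01].
- pose C1 := D `&` [set z | 2 * gap S' z.1 <= z.2 * largest z.1].
  pose C2 := D `&` [set z | z.2 * largest z.1 <= 2 * gap S' z.1].
  have -> : D = C1 `|` C2.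
    rewrite -setIUr; apply/esym/setIidl => z _ /=.
    by have [|/ltW] := leP (2 * gap S' z.1) (z.2 * largest z.1); [left|right].
  have cfst (U V : topologicalType) (f : U -> V) :
      continuous f -> continuous (fun z : U * R => f z.1).
    by move=> cf z; apply: continuous_comp; [exact: cvg_fst|exact: cf].
  have cgap := cfst _ _ _ (continuous_gap (S := S')).
  have clarge := cfst _ _ _ continuous_largest.
  have c2gap : continuous (fun z : 'rV[R]_p * R => 2 * gap S' z.1).
    by move=> z; apply: cvgM; [exact: cvg_cst|exact: cgap].
  have ctl : continuous (fun z : 'rV[R]_p * R => z.2 * largest z.1).
    by move=> z; apply: cvgM; [exact: cvg_snd|exact: clarge].
  have cc : continuous c.
    move=> z; apply: (@continuous_min R _ (fun z => gap S' z.1)); first exact: cgap.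
    by apply: cvgM; [exact: ctl|exact: cvg_cst].
  have ck : {within D, continuous k}.
    apply: within_continuous_squash => //; apply: continuous_subspaceT => //.
    by move=> z; exact: cvg_fst.
  have cD : closed D by apply: closed_cylinder; exact: closed_realization.
  apply: withinU_continuous.
  + by apply: closedI => //; exact: closed_le_fun.
  + by apply: closedI => //; exact: closed_le_fun.
  + apply: (@eq_within_continuous _ _ _ (h \o (fun z => (k z, tau z)))).
      by move=> z [_ /= zle]; rewrite /H zle.
    have ckt : {within C1, continuous (fun z => (k z, tau z))}.
      apply: within_continuous_pair; first by apply: continuous_subspaceW ck => z [].
      apply/within_continuousP => z [Dz _]; apply: cvg_within_filter.
      have [_ _ _ l0] := DE _ Dz.
      apply: cvgB; first exact: cvg_snd.
      by apply: cvgM; [exact: c2gap|apply: cvgV; [rewrite gt_eqF|exact: clarge]].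
    have kC1 z : C1 z -> (realization R S' `*` `[0, 1]) (k z, tau z).
      by move=> [Dz zle]; have [? ?] := near_kS z Dz zle; split=> //=; rewrite in_itv.
    exact: within_continuous_comp_in kC1 ckt ch.
  (* The two branches of [H] agree on the overlap: there [tau z] is 0 and [k z] lies in the
     realization of [S'], where [h] starts at [F]. *)
  + apply: (@eq_within_continuous _ _ _ (F \o k)).
      move=> z [Dz /= zle]; rewrite /H; case: ifP => // zge.
      have [_ _ _ l0] := DE _ Dz; have [kS' _] := near_kS _ Dz zge.
      rewrite (_ : tau z = 0) ?hF // /tau.
      have -> : 2 * gap S' z.1 = z.2 * largest z.1 by apply/le_anti; rewrite zge zle.
      by rewrite mulfK ?subrr // gt_eqF.
    apply: (within_continuous_comp_in _ _ cF); first by move=> z [/kS].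
    by apply: continuous_subspaceW ck => z [].
- have Dz : D (x, t) by split=> //=; rewrite in_itv.
  rewrite /H; case: ifPn => zle; last by apply: FY; exact: kS.
  by have [? ?] := near_kS _ Dz zle; exact: hY.
- have Dz : D (x, 0) by split=> //=; rewrite in_itv /= lexx ler01.
  have c0 : c (x, 0) = 0 by rewrite /c /= !mul0r min_r ?gap_ge0.
  rewrite /H (k0 _ Dz c0) /=; case: ifP => // zle.
  have g0 : gap S' x = 0 by apply/le_anti; rewrite gap_ge0 andbT; lra.
  rewrite /tau /= g0 mulr0 mul0r subr0 hF //.
  by apply: gap0_realization; [case/realizationE: xS|rewrite g0].
- have g0 := realization_gap0 S'D xS'.
  have xS : realization R S x.
    by case/realizationE: xS' => ? ?; apply/realizationE; split=> //;
    exact: (fintype.subsetP S'S).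
  have Dz : D (x, t) by split=> //=; rewrite in_itv.
  have [_ /= t0 _ l0] := DE _ Dz.
  have c0 : c (x, t) = 0 by rewrite /c /= g0 min_l // divr_ge0 // mulr_ge0 // ltW.
  rewrite /H (k0 _ Dz c0) /= /tau /= g0 mulr0 mul0r subr0 ifT //.
  by rewrite mulr_ge0 // ltW.
Qed.

End HomotopyExtension.

(** * Cubes, simplices and null-homotopies *)

Section CubeSimplex.
Variables (R : realType) (j : nat).
Implicit Types (y : 'rV[R]_j) (b : 'rV[R]_j.+1).

Let total y := \sum_k y ord0 k.

(* The corner simplex [y >= 0, total y <= 1] and the unit cube are exchanged by
   the radial rescaling that swaps [total y] and [largest y]. *)
Definition simplex_of_cube y : 'rV[R]_j.+1 :=
  \row_i (if unlift ord0 i is Some k then y ord0 k * (largest y / total y)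
          else 1 - largest y).

Definition corner b : 'rV[R]_j := \row_k b ord0 (lift ord0 k).

Definition cube_of_simplex b : 'rV[R]_j :=
  \row_k (b ord0 (lift ord0 k) * ((1 - b ord0 ord0) / largest (corner b))).

Let largest_ge0 y : 0 <= largest y. Proof. exact: bigmax_ge_id. Qed.

Let total0 y : (forall k, 0 <= y ord0 k) -> total y = 0 -> y = 0.
Proof.
move=> y0 ty; apply/rowP => k; rewrite mxE.
exact: (psumr_eq0P (P := xpredT) (F := fun k => y ord0 k)).
Qed.

Let largest_le_total y : (forall k, 0 <= y ord0 k) -> largest y <= total y.
Proof.
move=> y0; apply/bigmax_leP; split=> [|k _]; first exact: sumr_ge0.
by rewrite /total (bigD1 k) //= lerDl sumr_ge0.
Qed.

Let largest0 : largest (0 : 'rV[R]_j) = 0.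
Proof.
apply/le_anti; rewrite largest_ge0 andbT; apply/bigmax_leP.
by split=> // k _; rewrite mxE.
Qed.

Lemma simplex_of_cube_simplex y : cube y -> std_simplex (simplex_of_cube y).
Proof.
move=> yc; have y0 k : 0 <= y ord0 k by case/andP: (yc k).
have tot0 : 0 <= total y by exact: sumr_ge0.
split=> [i|].
  rewrite mxE; case: unliftP => [k|] _; first by rewrite mulr_ge0 ?divr_ge0.
  by rewrite subr_ge0; apply/bigmax_leP; split=> // k _; case/andP: (yc k).
rewrite big_ord_recl mxE unlift_none.
under eq_bigr do rewrite mxE liftK.
rewrite -mulr_suml -/(total y).
have [ty|ty] := eqVneq (total y) 0; last by rewrite mulrC divfK // subrK.
by rewrite ty mul0r addr0 (total0 y0 ty) largest0 subr0.
Qed.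

(** A zero coordinate stays zero under rescaling, and a coordinate equal to 1 makes the extra
    barycentric coordinate [1 - largest y] vanish. *)
Lemma simplex_of_cube_boundary y :
  cube_boundary y -> exists i, simplex_of_cube y ord0 i = 0.
Proof.
move=> [yc [k [yk|yk]]].
  by exists (lift ord0 k); rewrite mxE liftK yk mul0r.
exists ord0; rewrite mxE unlift_none; apply/eqP; rewrite subr_eq0; apply/eqP.
apply/le_anti/andP; split; first by rewrite -yk le_largest.
by apply/bigmax_leP; split=> // i _; case/andP: (yc i).
Qed.

Lemma continuous_simplex_of_cube :
  {within @cube R j, continuous simplex_of_cube}.
Proof.
have clargest : {within @cube R j, continuous (@largest R j)}.
  by apply: continuous_subspaceT; exact: continuous_largest.
apply: continuous_row => i; case: (unliftP ord0 i) => [k ->|->].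
  apply: (@eq_within_continuous _ _ _ (fun y => y ord0 k * (largest y / total y))).
    by move=> y _; rewrite mxE liftK.
  apply: (within_continuous_ratio (c := 1)) => //.
  - by apply: continuous_subspaceT; exact: coord_continuous.
  - by apply: continuous_subspaceT; apply: continuous_sum => l; exact: coord_continuous.
  - move=> y yc; have y0 l : 0 <= y ord0 l by case/andP: (yc l).
    by rewrite mul1r !ger0_norm ?largest_le_total //; exact: sumr_ge0.
  - move=> y yc ty; have y0 l : 0 <= y ord0 l by case/andP: (yc l).
    by rewrite (total0 y0 ty) mxE.
apply: (@eq_within_continuous _ _ _ (fun y => 1 - largest y)).
  by move=> y _; rewrite mxE unlift_none.
by move=> y; apply: continuousB; [exact: cst_continuous|exact: clargest].
Qed.

Let cornerP b : std_simplex b ->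
  [/\ forall k, 0 <= corner b ord0 k & total (corner b) = 1 - b ord0 ord0].
Proof.
move=> [b0 b1]; split=> [k|]; first by rewrite mxE.
rewrite -b1 big_ord_recl addrC addKr; by apply: eq_bigr => k _; rewrite mxE.
Qed.

Lemma cube_of_simplexE b :
  cube_of_simplex b = ((1 - b ord0 ord0) / largest (corner b)) *: corner b.
Proof. by apply/rowP => k; rewrite !mxE mulrC. Qed.

Let ratio_ge0 b : std_simplex b -> 0 <= (1 - b ord0 ord0) / largest (corner b).
Proof. by move=> bD; rewrite divr_ge0 // subr_ge0 std_simplex_le1. Qed.

Let largest_cube_of_simplex b : std_simplex b ->
  largest (cube_of_simplex b) = 1 - b ord0 ord0.
Proof.
move=> bD; have [c0 ct] := cornerP bD; rewrite cube_of_simplexE.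
have -> c y : 0 <= c -> largest (c *: y) = c * largest y.
  move=> cge0; rewrite /largest (big_morph _ (fun a d => maxr_pMr a d cge0) (mulr0 c)).
  by apply: eq_bigr => k _; rewrite mxE.
have [m0|m0] := eqVneq (largest (corner b)) 0; last by rewrite divfK.
rewrite m0 mulr0 -ct; apply/esym/big1 => k _; apply/le_anti.
by rewrite c0 andbT -m0 le_largest.
exact: ratio_ge0.
Qed.

Lemma cube_of_simplex_cube b : std_simplex b -> cube (cube_of_simplex b).
Proof.
move=> bD k; have [c0 ct] := cornerP bD; apply/andP; split.
  by rewrite cube_of_simplexE mxE mulr_ge0 ?ratio_ge0.
rewrite (le_trans (le_largest _ _)) // largest_cube_of_simplex // gerBl.
exact: bD.1.
Qed.

Lemma cube_of_simplex_boundary b i :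
  std_simplex b -> b ord0 i = 0 -> cube_boundary (cube_of_simplex b).
Proof.
move=> bD bi; split; first exact: cube_of_simplex_cube.
case: (unliftP ord0 i) bi => [k ->|->] bi.
  by exists k; left; rewrite mxE bi mul0r.
have := largest_cube_of_simplex bD; rewrite bi subr0 => l1.
have : 0 < largest (cube_of_simplex b) by rewrite l1.
(* A positive maximum is not the base value 0, so it is attained at some [k]; this also rules out
   [j = 0]. *)
have /bigmax_geP[|[k _ lek]] := lexx (largest (cube_of_simplex b)).
  by move=> /le_lt_trans h /h; rewrite ltxx.
by move=> _; exists k; right; apply/le_anti; rewrite -{2}l1 lek -l1 le_largest.
Qed.

Lemma cube_of_simplexK b : std_simplex b -> simplex_of_cube (cube_of_simplex b) = b.
Proof.
move=> bD; have [c0 ct] := cornerP bD; apply/rowP => i; rewrite mxE.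
rewrite largest_cube_of_simplex //; case: unliftP => [k ->|->]; last by rewrite subKr.
rewrite cube_of_simplexE mxE /total; under eq_bigr do rewrite mxE.
rewrite -mulr_sumr -/(total _) ct; set s := 1 - _; set m := largest _.
(* At the vertex [ord0] the corner is zero, and both sides vanish. *)
have [s0|s0] := eqVneq s 0.
  have := total0 c0 _; rewrite ct -/s s0 => /(_ erefl) cb.
  by rewrite !mul0r; move/rowP/(_ k): cb; rewrite !mxE.
have m0 : m != 0.
  apply: contra s0 => /eqP m0; rewrite /s -ct /total big1 // => l _.
  by apply/le_anti; rewrite c0 andbT -m0 le_largest.
by rewrite mxE; field; rewrite s0 m0.
Qed.

Lemma continuous_cube_of_simplex :
  {within @std_simplex R j.+1, continuous cube_of_simplex}.
Proof.
have ccoord i : {within @std_simplex R j.+1, continuous (fun b => b ord0 i)}.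
  by apply: continuous_subspaceT; exact: coord_continuous.
apply: continuous_row => k.
apply: (@eq_within_continuous _ _ _ (fun b =>
  b ord0 (lift ord0 k) * ((1 - b ord0 ord0) / largest (corner b)))).
  by move=> b _; rewrite mxE.
(* [1 - b ord0 ord0] is the sum of the [j] corner coordinates, hence at most [j] times the largest
   one. *)
apply: (within_continuous_ratio (c := j%:R)) => //.
- by move=> b; apply: continuousB; [exact: cst_continuous|exact: ccoord].
- have ccorner : continuous corner.
    apply: continuous_row => l.
    rewrite (_ : (fun b => _) = (fun b : 'rV[R]_j.+1 => b ord0 (lift ord0 l))).
      exact: coord_continuous.
    by apply/funext => b; rewrite mxE.
  have : continuous (@largest R j \o corner).
    move=> b; apply: continuous_comp; first exact: ccorner.
    exact: continuous_largest.
  exact: continuous_subspaceT.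
- move=> b bD; have [c0 ct] := cornerP bD.
  rewrite -ct !ger0_norm //; last exact: sumr_ge0.
  rewrite mulr_natl -[X in _ *+ X]card_ord -sumr_const; apply: ler_sum => l _.
  exact: le_largest.
- move=> b bD m0; have [c0 _] := cornerP bD.
  have <- : corner b ord0 k = b ord0 (lift ord0 k) by rewrite mxE.
  by apply/le_anti; rewrite c0 andbT -m0 le_largest.
Qed.

End CubeSimplex.

(** The class of [f] equals that of the constant map, which belongs to its own class by the constant
    homotopy. *)
Lemma trivial_pi_homotopic (R : realType) (T : topologicalType) (j : nat)
    (X : set T) (x0 : T) (f : 'rV[R]_j -> T) :
  X x0 -> trivial_pi R j X x0 -> based_map X x0 f ->
  homotopic_rel X x0 f (cst x0).
Proof.
move=> Xx0 piX fX.
have : @homotopy_set R T j X x0 (homotopy_class X x0 f) by exists f.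
rewrite piX => /= fE; suff : homotopy_class X x0 f (cst x0) by case.
rewrite fE; split; first split=> //.
- by apply: continuous_subspaceT; exact: cst_continuous.
- by move=> _ [s _ <-].
exists (cst x0); split=> //.
- by apply: continuous_subspaceT; exact: cst_continuous.
- by move=> _ [s _ <-].
Qed.

Lemma face_closed_powerset (p : nat) (s : {set 'I_p}) : face_closed (powerset s).
Proof.
split=> [|t u]; first by rewrite inE finset.sub0set.
by rewrite !inE => ts /fintype.subset_trans; apply.
Qed.

(** * Contracting a map on a face relative to its boundary *)

Section FaceNullhomotopy.
Variables (R : realType) (p : nat) (T : topologicalType) (X : set T) (x0 : T).
Variables (j : nat) (s : {set 'I_p}).
Notation face := (realization R (powerset s)).

(** Through the parametrisation of the face by the cube, [f] becomes a based map and its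
    null-homotopy is carried back. For a vertex, [j = 0], the boundary is empty and the result is a
    path to [x0]. *)
Lemma face_nullhomotopy (f : 'rV[R]_p -> T) :
  X x0 -> trivial_pi R j X x0 -> #|s| = j.+1 ->
  {within face, continuous f} -> (forall x, face x -> X (f x)) ->
  (forall x, face x -> supp x != s -> f x = x0) ->
  exists h : 'rV[R]_p * R -> T,
    [/\ {within face `*` `[0, 1], continuous h},
        forall x t, face x -> 0 <= t <= 1 -> X (h (x, t)),
        forall x, face x -> h (x, 0) = f x,
        forall x, face x -> h (x, 1) = x0 &
        forall x t, face x -> 0 <= t <= 1 -> supp x != s -> h (x, t) = x0].
Proof.
move=> Xx0 piX sj cf fX fx0.
have [v0 v0s] : exists v, v \in s by apply/finset.set0Pn; rewrite -card_gt0 sj.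
pose iota (k : 'I_j.+1) : 'I_p := nth v0 (enum s) k.
have size_s : size (enum s) = j.+1 by rewrite -cardE.
have iota_s k : iota k \in s by rewrite -mem_enum mem_nth // size_s.
have iota_inj : injective iota.
  by move=> k l /eqP; rewrite nth_uniq ?size_s ?enum_uniq // => /eqP/val_inj.
have iota_onto i : i \in s -> exists k, i = iota k.
  rewrite -mem_enum => ie; have := ie; rewrite -index_mem size_s => lt.
  by exists (Ordinal lt); rewrite /iota nth_index.
pose push (b : 'rV[R]_j.+1) : 'rV[R]_p :=
  \row_i \sum_k b ord0 k * (i == iota k)%:R.
pose pull (x : 'rV[R]_p) : 'rV[R]_j.+1 := \row_k x ord0 (iota k).
have push_iota b k : push b ord0 (iota k) = b ord0 k.
  rewrite mxE (bigD1 k) //= eqxx mulr1 big1 ?addr0 // => l lk.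
  by rewrite (inj_eq iota_inj) eq_sym (negbTE lk) mulr0.
have push_out b i : i \notin s -> push b ord0 i = 0.
  move=> si; rewrite mxE big1 // => k _.
  by case: eqP => [ik|_]; [rewrite ik iota_s in si|rewrite mulr0].
have sum_s x : (forall i, i \notin s -> x ord0 i = 0) ->
    \sum_i x ord0 i = \sum_k x ord0 (iota k) :> R.
  move=> xs; rewrite (bigID (mem s)) /= [X in _ + X]big1 // addr0.
  rewrite (eq_bigl (mem (iota @: finset.setT))%SET); last first.
    move=> i /=; apply/idP/imsetP => [/iota_onto[k ->]|[k _ ->]]; last exact: iota_s.
    by exists k; rewrite ?inE.
  rewrite big_imset //= => [|? ? _ _]; last exact: iota_inj.
  by apply: eq_bigl => k; rewrite !inE.
have faceP x : face x <-> std_simplex x /\ forall i, i \notin s -> x ord0 i = 0.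
  rewrite realizationE inE; split=> -[xD xs]; split=> //.
    move=> i si; apply/eqP/negPn/negP => xi.
    by have := fintype.subsetP xs i; rewrite inE xi (negbTE si) => /(_ isT).
  apply/fintype.subsetP => i; rewrite inE; apply: contraR => /xs ->.
  by [].
have pushP b : std_simplex b -> face (push b).
  move=> [b0 b1]; apply/faceP; split; last exact: push_out.
  split=> [i|]; first by rewrite mxE sumr_ge0 // => k _; rewrite mulr_ge0.
  rewrite sum_s; last exact: push_out.
  by under eq_bigr do rewrite push_iota.
have pullP x : face x -> std_simplex (pull x).
  case/faceP=> -[x_ge0 x1] xs; split=> [k|]; first by rewrite mxE.
  by under eq_bigr do rewrite mxE; rewrite -sum_s.
have pullK x : face x -> push (pull x) = x.
  case/faceP=> _ xs; apply/rowP => i; have [/iota_onto[k ->]|si] := boolP (i \in s).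
    by rewrite push_iota mxE.
  by rewrite push_out ?xs.
have cpush : continuous push.
  apply: continuous_row => i.
  rewrite (_ : (fun b => _) =
      (fun b : 'rV[R]_j.+1 => \sum_k b ord0 k * (i == iota k)%:R)).
    apply: continuous_sum => k.
    have ck : continuous ((fun b : 'rV[R]_j.+1 => b ord0 k) \* cst (i == iota k)%:R).
      move=> b; apply: continuousM; [exact: coord_continuous|exact: cst_continuous].
    exact: ck.
  by apply/funext => b; rewrite mxE.
have cpull : continuous pull.
  apply: continuous_row => k.
  rewrite (_ : (fun b => _) = (fun x : 'rV[R]_p => x ord0 (iota k))).
    exact: coord_continuous.
  by apply/funext => x; rewrite mxE.
pose e y := push (@simplex_of_cube R j y).
have eP y : cube y -> face (e y).
  by move=> yc; apply/pushP; exact: simplex_of_cube_simplex.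
have ce : {within @cube R j, continuous e}.
  apply: (within_continuous_comp_in (B := setT)) => //.
    exact: continuous_simplex_of_cube.
  exact: continuous_subspaceT.
have e_boundary y : cube_boundary y -> supp (e y) != s.
  move=> yb; have [k ek] := simplex_of_cube_boundary yb.
  apply/eqP => /setP/(_ (iota k)); rewrite inE iota_s push_iota ek eqxx.
  by [].
have : based_map X x0 (f \o e).
  split.
  - exact: within_continuous_comp_in eP ce cf.
  - by move=> _ [y yc <-]; apply/fX/eP.
  - by move=> y yb; apply: fx0; [apply: eP; case: yb|exact: e_boundary].
move/(trivial_pi_homotopic Xx0 piX) => [H [cH HX Hb H0 H1]].
(* Since [e (r x) = x] on the face, precomposing [H] with [r] gives a homotopy that starts at
   [f]. *)
pose r x := cube_of_simplex (pull x).
have rP x : face x -> cube (r x).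
  by move=> /pullP; exact: cube_of_simplex_cube.
have rb x : face x -> supp x != s -> cube_boundary (r x).
  move=> xf xs; have /fintype.subsetPn[i si] : ~~ (s \subset supp x).
    apply: contra xs => sx; rewrite finset.eqEsubset sx andbT.
    by case/realizationE: xf => _; rewrite inE.
  rewrite inE negbK => /eqP xi; have [k ik] := iota_onto i si.
  apply: (@cube_of_simplex_boundary _ _ _ k); first exact: pullP.
  by rewrite mxE -ik.
have eK x : face x -> e (r x) = x.
  by move=> xf; rewrite /e /r cube_of_simplexK ?pullK //; exact: pullP.
exists (fun z => H (r z.1, z.2)); split.
- have rC z : (face `*` `[0 : R, 1]) z -> (@cube R j `*` `[0 : R, 1]) (r z.1, z.2).
    by move=> [/= /rP zc z01]; split.
  have crz : {within face `*` `[0 : R, 1], continuous (fun z => (r z.1, z.2))}.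
    apply: within_continuous_pair; last first.
      by apply: continuous_subspaceT => z; exact: cvg_snd.
    apply: (within_continuous_comp_in (f := pull \o fst) (B := @std_simplex R j.+1)
      (g := @cube_of_simplex R j)).
    + by move=> z [/pullP].
    + apply: continuous_subspaceT => z.
      by apply: continuous_comp; [exact: cvg_fst|exact: cpull].
    + exact: continuous_cube_of_simplex.
  exact: within_continuous_comp_in rC crz cH.
- move=> x t xf t01; apply: HX; exists (r x, t) => //; split=> /=; first exact: rP.
  by rewrite in_itv.
- by move=> x xf /=; rewrite H0 /= ?eK //; exact: rP.
- by move=> x xf /=; rewrite H1 //; exact: rP.
- by move=> x t xf t01 xs /=; rewrite Hb //; exact: rb.
Qed.

End FaceNullhomotopy.

(** * Retraction of the full simplex *)

Section Extension.
Variables (R : realType) (p : nat) (S : {set {set 'I_p}}) (x0 : 'rV[R]_p).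
Notation X := (realization R S).
Hypotheses (S_closed : face_closed S) (Xx0 : X x0).
Hypothesis pi_trivial : forall (s : {set 'I_p}) j,
  s \in S -> #|s| = j.+1 -> trivial_pi R j X x0.

Lemma face_closed_setT : face_closed [set: {set 'I_p}]%SET.
Proof. by split=> [|s t]; rewrite !inE. Qed.

Lemma realization_setT : realization R [set: {set 'I_p}]%SET = @std_simplex R p.
Proof.
apply/seteqP; split=> x.
  case/realizationE => xD _. exact: xD.
by move=> xD; apply/realizationE; rewrite inE.
Qed.

Lemma realization_sub (S1 S2 : {set {set 'I_p}}) (x : 'rV[R]_p) :
  S1 \subset S2 -> realization R S1 x -> realization R S2 x.
Proof.
move=> S12 /realizationE[xD xS]; apply/realizationE; split=> //.
exact: (fintype.subsetP S12).
Qed.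

Lemma within_continuous_slice (A : set 'rV[R]_p) (H : 'rV[R]_p * R -> 'rV[R]_p) t :
  0 <= t <= 1 -> {within A `*` `[0, 1], continuous H} ->
  {within A, continuous (fun x => H (x, t))}.
Proof.
move=> t01 cH; have tA x : A x -> (A `*` `[0 : R, 1]) (x, t).
  by split=> //=; rewrite in_itv.
apply: (within_continuous_comp_in tA _ cH); apply: within_continuous_pair.
  by apply: continuous_subspaceT => x; exact: cvg_id.
by apply: continuous_subspaceT; exact: cst_continuous.
Qed.

Lemma extend_along_homotopy (H : 'rV[R]_p * R -> 'rV[R]_p)
    (F : 'rV[R]_p -> 'rV[R]_p) :
  {within X `*` `[0, 1], continuous H} ->
  (forall x t, X x -> 0 <= t <= 1 -> X (H (x, t))) ->
  {within @std_simplex R p, continuous F} ->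
  (forall x, std_simplex x -> X (F x)) ->
  (forall x, X x -> F x = H (x, 1)) ->
  exists G : 'rV[R]_p -> 'rV[R]_p,
    [/\ {within @std_simplex R p, continuous G},
        forall x, std_simplex x -> X (G x) &
        forall x, X x -> G x = H (x, 0)].
Proof.
rewrite -realization_setT => cH HX cF FX FH.
(* Time is reversed because the map known to extend, [F], agrees with the end of [H], while
   [homotopy_extension] starts from time 0. *)
pose h (z : 'rV[R]_p * R) := H (z.1, 1 - z.2).
have rev z : (X `*` `[0 : R, 1]) z -> (X `*` `[0 : R, 1]) (z.1, 1 - z.2).
  move=> [zX]; rewrite /= !in_itv /= => /andP[z0 z1]; split=> //=.
  by apply/andP; split; lra.
have ch : {within X `*` `[0 : R, 1], continuous h}.
  apply: (within_continuous_comp_in rev _ cH); apply: within_continuous_pair.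
    by apply: continuous_subspaceT => z; exact: cvg_fst.
  apply: continuous_subspaceT => z.
  by apply: cvgB; [exact: cvg_cst|exact: cvg_snd].
have hX x t : X x -> 0 <= t <= 1 -> X (h (x, t)).
  by move=> xX t01; apply: HX => //=; lra.
have hF x : X x -> h (x, 0) = F x by move=> xX; rewrite /h /= subr0 FH.
have [K [cK KX _ Kh]] := homotopy_extension S_closed face_closed_setT
  (finset.subsetT S) cF FX ch hX hF.
have i01 : (0 : R) <= (1 : R) <= (1 : R) by rewrite ler01 lexx.
exists (fun x => K (x, 1)); split.
- exact: within_continuous_slice cK.
- by move=> x xD; exact: KX.
- by move=> x xX; rewrite Kh // /h /= subrr.
Qed.

(* The map is deformed to one that is also constant on a minimal new face; by
   induction the new map extends, and homotopy extension carries the extension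
   back along the deformation. *)
Lemma extend_from_simplex (S' : {set {set 'I_p}}) (f : 'rV[R]_p -> 'rV[R]_p) :
  face_closed S' -> S' \subset S ->
  {within X, continuous f} -> (forall x, X x -> X (f x)) ->
  (forall x, realization R S' x -> f x = x0) ->
  exists F : 'rV[R]_p -> 'rV[R]_p,
    [/\ {within @std_simplex R p, continuous F},
        forall x, std_simplex x -> X (F x) & forall x, X x -> F x = f x].
Proof.
(* The induction is on the number of faces of [S] not yet known to be sent to [x0]. *)
have [k] := ubnP #|S :\: S'|.
elim: k S' f => // k IHk S' f Sk S'_closed S'S cf fX fx0.
have [SS'|] := boolP (S \subset S').
  exists (cst x0); split=> //.
    by apply: continuous_subspaceT; exact: cst_continuous.
  by move=> x xX; rewrite fx0 //; exact: realization_sub SS' xX.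
case/fintype.subsetPn => s1 s1S s1S'.
case: (@arg_minnP _ s1 (fun s => (s \in S) && (s \notin S')) (fun s => #|s|)).
  by rewrite s1S.
move=> s /andP[sS sS'] smin.
(* By minimality the boundary of [s] lies in [S'], so [f] is constant on it and [s] can be
   contracted relative to its boundary. *)
have proper_s (t : {set 'I_p}) : t \subset s -> t != s -> t \in S'.
  move=> ts tns; apply/negPn/negP => tS'.
  have tS := S_closed.2 _ _ sS ts.
  have := smin t; rewrite tS tS' => /(_ isT); apply/negP; rewrite -ltnNge.
  by apply: proper_card; rewrite finset.properEneq tns.
pose S2 := (s |: S')%SET.
have S2_closed : face_closed S2.
  split=> [|u t]; first by rewrite inE S'_closed.1 orbT.
  rewrite !inE => /orP[/eqP->|uS'] ts; last by rewrite (S'_closed.2 _ _ uS' ts) orbT.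
  by have [//|tns] := eqVneq t s; rewrite (proper_s t).
have S2S : S2 \subset S by rewrite finset.subUset finset.sub1set sS.
have sPS : powerset s \subset S.
  by apply/fintype.subsetP => t; rewrite inE; exact: S_closed.2.
have sP2 : powerset s \subset S2.
  apply/fintype.subsetP => t; rewrite !inE => ts.
  by have [//|tns] := eqVneq t s; rewrite (proper_s t).
have s_gt0 : (0 < #|s|)%N.
  by rewrite card_gt0; apply: contraNneq sS' => ->; exact: S'_closed.1.
pose j := #|s|.-1; have sj : #|s| = j.+1 by rewrite /j prednK.
have [h [ch hX h0 h1 hb]] : exists h : 'rV[R]_p * R -> 'rV[R]_p,
    [/\ {within realization R (powerset s) `*` `[0, 1], continuous h},
        forall x t, realization R (powerset s) x -> 0 <= t <= 1 -> X (h (x, t)),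
        forall x, realization R (powerset s) x -> h (x, 0) = f x,
        forall x, realization R (powerset s) x -> h (x, 1) = x0 &
        forall x t, realization R (powerset s) x -> 0 <= t <= 1 ->
          supp x != s -> h (x, t) = x0].
  apply: (face_nullhomotopy Xx0 (pi_trivial sS sj) sj).
  - apply: continuous_subspaceW cf => x; exact: realization_sub.
  - by move=> x xs; apply: fX; exact: realization_sub xs.
  - move=> x /realizationE[xD]; rewrite inE => xs xns; apply: fx0.
    by apply/realizationE; split=> //; exact: proper_s.
(* The contraction of [s] is glued with the constant homotopy on [S']; on common points the support
   is a proper face of [s], where both equal [x0]. *)
pose h2 (z : 'rV[R]_p * R) := if supp z.1 \subset s then h z else x0.
have h2X x t : realization R S2 x -> 0 <= t <= 1 -> X (h2 (x, t)).
  move=> /realizationE[xD _] t01; rewrite /h2 /=; case: ifP => // xs.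
  by apply: hX => //; apply/realizationE; rewrite inE.
have h2f x : realization R S2 x -> h2 (x, 0) = f x.
  move=> /realizationE[xD xS2]; rewrite /h2 /=; case: ifPn => [xs|xns].
    by apply: h0; apply/realizationE; rewrite inE.
  rewrite fx0 //; apply/realizationE; split=> //.
  by move: xS2; rewrite !inE => /orP[/eqP xs|//]; rewrite xs fintype.subxx in xns.
have h21 x : realization R S2 x -> h2 (x, 1) = x0.
  move=> /realizationE[xD _]; rewrite /h2 /=; case: ifP => // xs.
  by apply: h1; apply/realizationE; rewrite inE.
have ch2 : {within realization R S2 `*` `[0, 1], continuous h2}.
  have -> : realization R S2 `*` `[0, 1] =
      (realization R (powerset s) `*` `[0, 1]) `|` (realization R S' `*` `[0 : R, 1]).
    apply/seteqP; split=> [z [/realizationE[zD]]|z].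
      rewrite !inE => /orP[/eqP zs|zS'] z01; [left|right]; split=> //.
        by apply/realizationE; rewrite inE zs fintype.subxx.
      by apply/realizationE.
    case=> -[zS z01]; split=> //; apply: realization_sub zS => //.
    exact: finset.subsetUr.
  apply: withinU_continuous.
  - by apply/closed_cylinder/closed_realization/face_closed_powerset.
  - exact/closed_cylinder/closed_realization.
  - apply: eq_within_continuous ch => z [/realizationE[_]].
    by rewrite inE /h2 => ->.
  - apply: (@eq_within_continuous _ _ _ (cst x0)).
      move=> [x t] [/realizationE[/= xD xS']]; rewrite /h2 /= in_itv /= => t01.
      case: ifP => // xs; rewrite hb //; first by apply/realizationE; rewrite inE.
      by apply: contraNneq sS' => <-.
    by apply: continuous_subspaceT; exact: cst_continuous.
have [H [cH HX Hf Hh2]] :=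
  homotopy_extension S2_closed S_closed S2S cf fX ch2 h2X h2f.
have i01 : (0 : R) <= (1 : R) <= (1 : R) by rewrite ler01 lexx.
have [] := IHk S2 (fun x => H (x, 1)) _ S2_closed S2S.
- rewrite -ltnS (leq_trans _ Sk) // ltnS proper_card //.
  apply/fintype.properP; split; first by apply: finset.setDS; exact: finset.subsetUr.
  by exists s; rewrite !inE ?sS ?sS' ?eqxx.
- exact: within_continuous_slice cH.
- by move=> x xX; exact: HX.
- by move=> x xS2; rewrite Hh2 // h21.
move=> F [cF FX FH]; have [G [cG GX GH]] := extend_along_homotopy cH HX cF FX FH.
by exists G; split=> // x xX; rewrite GH // Hf.
Qed.

Lemma simplex_retraction : exists r : 'rV[R]_p -> 'rV[R]_p,
  [/\ {within @std_simplex R p, continuous r},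
      forall x, std_simplex x -> X (r x) & forall x, X x -> r x = x].
Proof.
(* The complex whose only face is empty has empty realization, so the identity satisfies the
   condition of being [x0] there. *)
apply: (@extend_from_simplex [set finset.set0]%SET id) => //.
- by split=> [|s t]; rewrite !inE // => /eqP->; rewrite finset.subset0.
- by rewrite finset.sub1set S_closed.1.
- by apply: continuous_subspaceT => x; exact: cvg_id.
- move=> x /realizationE[[_ x1]]; rewrite inE => /eqP/setP xs.
  suff : 1 = 0 :> R by move/eqP; rewrite oner_eq0.
  rewrite -x1 big1 // => i _; have := xs i; rewrite !inE => /negbFE/eqP.
  by [].
Qed.

End Extension.

(** * Rotation-invariant complexes *)

Section CyclicComplexes.
Variables (n : nat) (S : {set {set 'I_n.+1}}).
Hypotheses (S_complex : simplicial_complex S) (S_cyclic : cyclic_invariant S).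

Lemma card_face_independent (s A : {set 'I_n.+1}) :
  s \in S -> independent S A -> (#|s| * #|A| <= n.+1)%N.
Proof.
move=> sS Aind; have [SD _] := S_complex.
have rotS (k : nat) : [set iter k (@ordS n.+1) i | i in s]%SET \in S.
  elim: k => [|k IHk].
    rewrite (_ : [set _ | _ in _]%SET = s) //; apply/setP => i.
    by apply/imsetP/idP => [[j ? ->//]|]; exists i.
  have := S_cyclic IHk; rewrite -imset_comp.
  by rewrite (eq_imset (g := fun i => iter k.+1 (@ordS n.+1) i)).
have iter_val (k : nat) (i : 'I_n.+1) :
    iter k (@ordS n.+1) i = ((i + k) %% n.+1)%N :> nat.
  elim: k => [|k IHk]; first by rewrite addn0 modn_small.
  by rewrite iterS /= IHk -addn1 modnDml addn1 addnS.
have iterE (k i : 'I_n.+1) : iter k (@ordS n.+1) i = i + k.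
  by apply: val_inj; rewrite /= iter_val.
pose f (z : 'I_n.+1 * 'I_n.+1) := z.2 - z.1.
have f_inj : {in finset.setX s A &, injective f}.
  move=> [u a] [v b]; rewrite !inE /= => /andP[us aA] /andP[vs bA].
  (* Equal differences mean that the same rotation of [s] sends [u] to [a] and [v] to [b]; distinct
     [a] and [b] would then form an edge. *)
  rewrite /f /= => eq; have ab : a = b.
    apply/eqP/negPn/negP => ab; have := Aind a b aA bA ab; apply/negP/negPn.
    apply: SD (rotS (val (a - u))) _; apply/fintype.subsetP => i.
    rewrite !inE => /orP[]/eqP->; apply/imsetP; [exists u|exists v] => //.
      by rewrite iterE addrC subrK.
    by rewrite iterE eq addrC subrK.
  by move: eq; rewrite ab => /addrI/oppr_inj ->.
rewrite -cardsX -(card_in_imset f_inj) -[X in (_ <= X)%N]card_ord.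
exact: max_card.
Qed.

Variable R : realType.

Definition rotate (x : 'rV[R]_n.+1) : 'rV[R]_n.+1 := \row_i x ord0 (ord_pred i).

Lemma supp_rotate x : supp (rotate x) = (@ordS n.+1 @: supp x)%SET.
Proof.
apply/setP => i; rewrite inE mxE; apply/idP/imsetP => [xi|[k]].
  by exists (ord_pred i); rewrite ?inE // ord_predK.
by rewrite inE => xk ->; rewrite ordSK.
Qed.

Lemma rotate_realization x : realization R S x -> realization R S (rotate x).
Proof.
move=> /realizationE[[x0 x1] xS]; apply/realizationE; split.
  split=> [i|]; first by rewrite mxE.
  rewrite -x1 (reindex_inj (@ordS_inj n.+1)).
  by apply: eq_bigr => i _; rewrite mxE ordSK.
by rewrite supp_rotate; exact: S_cyclic.
Qed.

Lemma continuous_rotate : continuous rotate.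
Proof.
apply: continuous_row => i.
rewrite [X in continuous X](_ : _ = (fun x : 'rV[R]_n.+1 => x ord0 (ord_pred i))).
  exact: coord_continuous.
by apply/funext => x; rewrite mxE.
Qed.

Lemma rotate_fixed (x : 'rV[R]_n.+1) : \sum_i x ord0 i = 1 -> rotate x = x ->
  supp x = [set: 'I_n.+1]%SET.
Proof.
move=> x1 /rowP xfix.
have xE i : x ord0 i = x ord0 ord0.
  case: i; elim=> [|i IHi] ilt; first by congr (x _ _); exact: val_inj.
  rewrite -(IHi (ltnW ilt)) -xfix mxE; congr (x _ _); apply: val_inj.
  by rewrite /= modnDr modn_small // ltnW.
apply/setP => i; rewrite !inE xE; apply/eqP => xi.
by move: x1; rewrite big1 => [/esym/eqP|k _]; rewrite ?oner_eq0 // xE.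
Qed.

Lemma face_closed_complex : face_closed S.
Proof.
have [SD Sv] := S_complex; split; last exact: SD.
by apply: (SD _ _ (Sv ord0)); exact: finset.sub0set.
Qed.

Lemma cyclic_simplex :
  (forall s : {set 'I_n.+1}, forall j, s \in S -> #|s| = j.+1 ->
    forall x, realization R S x -> trivial_pi R j (realization R S) x) ->
  [set: 'I_n.+1]%SET \in S.
Proof.
move=> piS; have S_closed := face_closed_complex.
pose x0 : 'rV[R]_n.+1 := delta_mx ord0 ord0.
have Sx0 : realization R S x0.
  apply/realizationE; split.
    split=> [i|]; first by rewrite mxE.
    rewrite (bigD1 ord0) //= big1 ?mxE ?eqxx ?addr0 // => i i0.
    by rewrite mxE eqxx (negbTE i0).
  rewrite (_ : supp x0 = [set ord0]%SET); first by case: S_complex.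
  by apply/setP => i; rewrite !inE mxE eqxx /= pnatr_eq0 eqb0 negbK.
have [r [cr rS rid]] := simplex_retraction S_closed Sx0
  (fun s j sS sj => piS s j sS sj x0 Sx0).
have [x xD xE] : exists2 x, std_simplex x & (rotate \o r) x = x.
  apply: brouwer => [x xD|].
    by have /realizationE[] := rotate_realization (rS _ xD).
  apply: (within_continuous_comp_in (B := setT)) cr _ => //.
  by apply: continuous_subspaceT; exact: continuous_rotate.
(* All values of [rotate \o r] lie in the realization, so the fixed point does too, and there [r] is
   the identity. *)
have Sx : realization R S x by rewrite -xE; exact/rotate_realization/rS.
have xfix : rotate x = x by rewrite -[in RHS]xE /= rid.
by rewrite -(rotate_fixed xD.2 xfix); case/realizationE: Sx.
Qed.

End CyclicComplexes.

(** * Comparing dimension with connectivity *)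

Theorem theorem4p5 (R : realType) (q : nat) (g : nat -> R) :
  (2 <= q)%N ->
  g p / p%:R @[p --> within [set p : nat | prime p] \oo] --> (0 : R) ->
  exists N : nat, forall p : nat, prime p -> (N <= p)%N ->
    forall S : {set {set 'I_p}},
      simplicial_complex S ->
      cyclic_invariant S ->
      k_connected (realization R S) (p%:R / q%:R - g p) ->
      forall A : {set 'I_p}, independent S A -> (#|A| <= q)%N.
Proof.
move=> q2 gp.
have q0 : 0 < q%:R :> R by rewrite ltr0n (leq_trans _ q2).
(* The bound [g p / p < e] says exactly that [p / (q+1) < p / q - g p]. *)
pose e : R := q%:R^-1 - q.+1%:R^-1.
have e0 : 0 < e.
  by rewrite subr_gt0 ltf_pV2 ?posrE ?ltr0n ?ltr_nat // (leq_trans _ q2).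
have [N _ gN] : \forall p \near \oo, prime p -> g p / p%:R < e.
  by move/cvgr_lt: gp => /(_ _ e0); rewrite near_withinE.
exists N; case=> // n pr_p Np S S_complex S_cyclic [_ conn] A Aind.
rewrite leqNgt; apply/negP => qA.
have p0 : 0 < n.+1%:R :> R by rewrite ltr0n.
have : [set: 'I_n.+1]%SET \in S.
  apply: (cyclic_simplex S_complex S_cyclic (R := R)) => s j sS sj.
  apply: conn.
  (* A face with [j + 1] vertices against at least [q + 1] independent ones gives [j < p / (q+1)], a
     degree in which the homotopy is trivial. *)
  have : (j.+1 * q.+1 <= n.+1)%N.
    rewrite -sj; apply: leq_trans (card_face_independent S_complex S_cyclic sS Aind).
    by rewrite leq_mul2l qA orbT.
  rewrite -(ler_nat R) natrM -ler_pdivlMr ?ltr0n // => jle.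
  have := gN _ Np pr_p; rewrite ltr_pdivrMr // /e mulrBl => glt.
  have : j%:R <= j.+1%:R :> R by rewrite ler_nat.
  move/le_trans => -> //; rewrite (le_trans jle) //.
  by move: glt; rewrite ![_^-1 * _]mulrC ltrBrDr lerBrDr addrC => /ltW.
move=> setTS; have : (1 < #|A|)%N by apply: leq_trans qA; exact: ltnW.
case/card_gt1P => u [v [uA vA uv]]; have := Aind u v uA vA uv.
by rewrite (S_complex.1 _ _ setTS) // finset.subsetT.
Qed.
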